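(* Let $E$ be a Banach space and $X$ a linearly stable, finitely dominated and spherically complete sequence class. (a) The map $J: X^{\rm dual}(E')\to X(E)'$, $J((\varphi_j)_{j=1}^\infty)((x_j)_{j=1}^\infty)=\sum_{j=1}^\infty\varphi_j(x_j)$, is a well-defined injective continuous linear operator (with $\|J\|\le1$). Suppose in addition that $X$ is finitely injective. Then: (b) $J$ is an isometric isomorphism from $X^{\rm dual}(E')$ onto a complemented subspace of $X(E)'$; (c) $J$ is an isometric isomorphism from $X^{\rm dual}(E')$ onto $X(E)'$ if and only if $c_{00}(E)$ is dense in $X(E)$.
   Context: Banach spaces over $\mathbb{K}=\mathbb{R}$ or $\mathbb{C}$; $E'$ dual, $E''$ bidual; $B_Z$ closed unit ball; $x\cdot e_j$ the sequence with $x$ in coordinate $j$ and $0$ elsewhere; $c_{00}(E)$ finitely supported sequences; $\ell_\infty(E)$ bounded sequences with sup norm; finite families $(x_j)_{j=1}^k$ are identified with $(x_1,\dots,x_k,0,\dots)$. A sequence class is a rule $X$ assigning to each Banach space $E$ a Banach space $X(E)$, a linear subspace of $E^{\mathbb{N}}$, with $c_{00}(E)\subseteq X(E)\subseteq\ell_\infty(E)$, $\|\cdot\|_\infty\le\|\cdot\|_{X(E)}$ and $\|x\cdot e_j\|_{X(E)}=\|x\|$. For $T\in\mathcal L(E;F)$, $\widehat T((x_j))=(T(x_j))$. $X$ is linearly stable if for all $E,F$ and $T\in\mathcal L(E;F)$, $\widehat T$ maps $X(E)$ into $X(F)$ with $\|\widehat T\|=\|T\|$. $X$ is finitely determined if $(x_j)\in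 X(E)$ iff $\sup_k\|(x_j)_{j=1}^k\|_{X(E)}<\infty$, and then $\|(x_j)\|_{X(E)}=\sup_k\|(x_j)_{j=1}^k\|_{X(E)}$. $X$ is finitely dominated if there is a finitely determined sequence class $Y$ such that for every $E$, $X(E)$ is a closed subspace of $Y(E)$ and either (I) for all $(x_j)\in Y(E)$: $(x_j)\in X(E)$ iff $\lim_k\|(x_j)_{j=k}^\infty\|_{Y(E)}=0$; or (II) for all $(x_j)\in Y(E)$: $(x_j)\in X(E)$ iff $\lim_{k,l}\|(x_j)_{j=k}^l\|_{Y(E)}=0$. $X$ is spherically complete if $(x_j)\in X(E)$, $|\lambda_j|=1$ imply $(\lambda_jx_j)\in X(E)$ with equal norm. $X$ is finitely injective if $\|(x_j)_{j=1}^k\|_{X(E)}\le\|(i(x_j))_{j=1}^k\|_{X(F)}$ whenever $i:E\to F$ is a metric injection (linear isometric embedding), $k\in\mathbb{N}$, $x_1,\dots,x_k\in E$. The dual class: $X^{\rm dual}(G)=\{(x_j)\in G^{\mathbb{N}}:\sum_j\varphi_j(x_j)\text{ converges for all }(\varphi_j)\in X(G')\}$ with norm $\sup_{(\varphi_j)\in B_{X(G')}}\sum_j|\varphi_j(x_j)|$; in particular $X^{\rm dual}(E')$ is defined via $X(E'')$. *)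

(* Defs.v *)
(* Scalars: K = R (b = false) or
   K = R[i] = complex R (b = true), for an arbitrary R : realType.
   Banach spaces over K are 'completeNormedModType K'; norms are K-valued
   (library convention; they are nonnegative reals in K). *)
From HB Require Import structures.
From mathcomp Require Import all_boot all_order all_algebra.
From mathcomp Require Import all_classical all_reals all_analysis.
From mathcomp Require Import complex.

Import Order.TTheory GRing.Theory Num.Theory Num.Def numFieldNormedType.Exports.
Local Open Scope ring_scope.
Local Open Scope classical_set_scope.

Definition scalars (R : realType) (b : bool) : numFieldType :=
  if b then (R[i] : numFieldType) else (R : numFieldType).

Section SeqClasses.
Context {K : numFieldType}.

(** Operations on sequences (indices start at 0; "(x_j)_{j=1}^k" is trunc k). *)
Definition single {E : normedModType K} (v : E) (j : nat) : nat -> E :=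
  fun i => if i == j then v else 0.
Definition trunc {E : normedModType K} (k : nat) (x : nat -> E) : nat -> E :=
  fun j => if (j < k)%N then x j else 0.
Definition tailseq {E : normedModType K} (k : nat) (x : nat -> E) : nat -> E :=
  fun j => if (k <= j)%N then x j else 0.
Definition segseq {E : normedModType K} (k l : nat) (x : nat -> E) : nat -> E :=
  fun j => if (k <= j <= l)%N then x j else 0.
Definition finsupp {E : normedModType K} (x : nat -> E) : Prop :=
  exists n, forall j, (n <= j)%N -> x j = 0.
Definition bounded_seq {E : normedModType K} (x : nat -> E) : Prop :=
  exists M : K, forall j, `|x j| <= M.

Record seqclass := SeqClass {
  sc_mem : forall E : completeNormedModType K, set (nat -> E);
  sc_norm : forall E : completeNormedModType K, (nat -> E) -> K }.


Definition banach_subspace {E : normedModType K} (S : set (nat -> E))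
    (N : (nat -> E) -> K) : Prop :=
  [/\ (S (fun _ => 0) /\
         forall (a : K) x y, S x -> S y -> S (fun j => a *: x j + y j)),
      (forall x, S x -> 0 <= N x),
      ((forall x, S x -> N x = 0 -> x = (fun _ => 0)) /\
       forall (a : K) x, S x -> N (fun j => a *: x j) = `|a| * N x),
      (forall x y, S x -> S y -> N (fun j => x j + y j) <= N x + N y)
    & (forall u : nat -> nat -> E, (forall n, S (u n)) ->
        (forall e : K, 0 < e -> exists n0, forall m n, (n0 <= m)%N -> (n0 <= n)%N ->
            N (fun j => u m j - u n j) < e) ->
        exists2 l, S l & forall e : K, 0 < e -> exists n0, forall n, (n0 <= n)%N ->
            N (fun j => u n j - l j) < e)].

Definition is_seqclass (X : seqclass) : Prop :=
  forall E : completeNormedModType K,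
  [/\ banach_subspace (sc_mem X E) (sc_norm X E),
      (forall x, finsupp x -> sc_mem X E x),
      (forall x, sc_mem X E x -> bounded_seq x),
      (forall x j, sc_mem X E x -> `|x j| <= sc_norm X E x)
    & (forall (v : E) j, sc_norm X E (single v j) = `|v|)].

Definition is_opnorm {U V : Type} (dom : set U) (nU : U -> K) (f : U -> V)
    (nV : V -> K) (c : K) : Prop :=
  [/\ 0 <= c,
      (forall u, dom u -> nV (f u) <= c * nU u)
    & (forall c', 0 <= c' -> (forall u, dom u -> nV (f u) <= c' * nU u) -> c <= c')].

Definition linearly_stable (X : seqclass) : Prop :=
  forall (E F : completeNormedModType K) (T : {linear E -> F}), continuous T ->
    (forall x, sc_mem X E x -> sc_mem X F (T \o x)) /\
    (forall c, is_opnorm setT normr T normr c ->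
       is_opnorm (sc_mem X E) (sc_norm X E) (fun x => T \o x) (sc_norm X F) c).

Definition finitely_determined (X : seqclass) : Prop :=
  forall (E : completeNormedModType K) (x : nat -> E),
    (sc_mem X E x <-> exists M : K, forall k, sc_norm X E (trunc k x) <= M) /\
    (sc_mem X E x ->
       supremums (range (fun k => sc_norm X E (trunc k x))) (sc_norm X E x)).

Definition closed_subspace_of (X Y : seqclass) (E : completeNormedModType K) : Prop :=
  [/\ (forall x, sc_mem X E x -> sc_mem Y E x),
      (forall x, sc_mem X E x -> sc_norm X E x = sc_norm Y E x)
    & (forall (u : nat -> nat -> E) l, (forall n, sc_mem X E (u n)) -> sc_mem Y E l ->
        (forall e : K, 0 < e -> exists n0, forall n, (n0 <= n)%N ->
            sc_norm Y E (fun j => u n j - l j) < e) ->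
        sc_mem X E l)].

Definition lim0 (u : nat -> K) : Prop :=
  forall e : K, 0 < e -> exists n0, forall k, (n0 <= k)%N -> `|u k| < e.
Definition lim0_2 (u : nat -> nat -> K) : Prop :=
  forall e : K, 0 < e -> exists n0, forall k l, (n0 <= k)%N -> (n0 <= l)%N -> `|u k l| < e.

Definition finitely_dominated (X : seqclass) : Prop :=
  exists Y : seqclass, [/\ is_seqclass Y, finitely_determined Y &
    forall E : completeNormedModType K, closed_subspace_of X Y E /\
      ((forall x, sc_mem Y E x ->
          (sc_mem X E x <-> lim0 (fun k => sc_norm Y E (tailseq k x)))) \/
       (forall x, sc_mem Y E x ->
          (sc_mem X E x <-> lim0_2 (fun k l => sc_norm Y E (segseq k l x)))))].

Definition spherically_complete (X : seqclass) : Prop :=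
  forall (E : completeNormedModType K) (x : nat -> E) (lam : nat -> K),
    sc_mem X E x -> (forall j, `|lam j| = 1) ->
    sc_mem X E (fun j => lam j *: x j) /\
    sc_norm X E (fun j => lam j *: x j) = sc_norm X E x.

Definition finitely_injective (X : seqclass) : Prop :=
  forall (E F : completeNormedModType K) (i : {linear E -> F}),
    (forall v, `|i v| = `|v|) ->
    forall (k : nat) (x : nat -> E),
      sc_norm X E (trunc k x) <= sc_norm X F (trunc k (i \o x)).

(** ev : D -> E -> K identifies D isometrically and linearly with the dual E'
    (d |-> ev d is a linear isometric bijection onto the continuous linear
    functionals on E, with the operator norm). *)
Definition dual_pairing {E D : normedModType K} (ev : D -> E -> K) : Prop :=
  [/\ (forall d (a : K) x y, ev d (a *: x + y) = a * ev d x + ev d y),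
      (forall x (a : K) d d', ev (a *: d + d') x = a * ev d x + ev d' x),
      (forall d, is_opnorm setT normr (ev d) normr `|d|)
    & (forall f : E -> K, (forall (a : K) x y, f (a *: x + y) = a * f x + f y) ->
         continuous f -> exists d, forall x, ev d x = f x)].

(** The dual class X^dual(G), where ev : H -> G -> K realizes H = G'. *)
Definition Xdual_mem (X : seqclass) {G H : completeNormedModType K}
    (ev : H -> G -> K) (x : nat -> G) : Prop :=
  forall psi, sc_mem X H psi -> cvgn (series (fun j => ev (psi j) (x j))).

(** c = sup_{psi in B_{X(G')}} sum_j |psi_j(x_j)|  (written as the least upper
    bound of all partial sums of these nonnegative series). *)
Definition Xdual_normis (X : seqclass) {G H : completeNormedModType K}
    (ev : H -> G -> K) (x : nat -> G) (c : K) : Prop :=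
  [/\ 0 <= c,
      (forall psi, sc_mem X H psi -> sc_norm X H psi <= 1 ->
         forall n, \sum_(0 <= j < n) `|ev (psi j) (x j)| <= c)
    & (forall c', 0 <= c' ->
         (forall psi, sc_mem X H psi -> sc_norm X H psi <= 1 ->
            forall n, \sum_(0 <= j < n) `|ev (psi j) (x j)| <= c') -> c <= c')].

Definition Jmap {E G : completeNormedModType K} (ev : G -> E -> K)
    (phi : nat -> G) (x : nat -> E) : K :=
  limn (series (fun j => ev (phi j) (x j))).

(** Elements of the dual X(E)': linear functionals on X(E) that are bounded
    (equivalently continuous) for the norm of X(E). *)
Definition bounds_on (X : seqclass) (E : completeNormedModType K)
    (Phi : (nat -> E) -> K) (c : K) : Prop :=
  forall x, sc_mem X E x -> `|Phi x| <= c * sc_norm X E x.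

Definition in_XEdual (X : seqclass) (E : completeNormedModType K)
    (Phi : (nat -> E) -> K) : Prop :=
  (forall (a : K) x y, sc_mem X E x -> sc_mem X E y ->
      Phi (fun j => a *: x j + y j) = a * Phi x + Phi y) /\
  exists c, bounds_on X E Phi c.

End SeqClasses.

(* Main.v *)
Require Import Defs.
From HB Require Import structures.
From mathcomp Require Import all_boot all_order all_algebra.
From mathcomp Require Import all_classical all_reals all_analysis.
From mathcomp Require Import complex ring lra.
Import Order.TTheory GRing.Theory Num.Theory Num.Def numFieldNormedType.Exports.
Local Open Scope ring_scope.
Local Open Scope classical_set_scope.
Set Implicit Arguments.
Unset Strict Implicit.
Unset Printing Implicit Defensive.

(** If [X] is finitely dominated by [Y], then, [Y] being finitely determined,
    alternatives (I) and (II) both say that the truncations of [x] in [X(E)]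
    converge to [x].  So [c_00(E)] is always dense, a functional on [X(E)] is
    determined by its coordinates [phi_j v = Phi (v . e_j)], and the projection
    in (b) can be taken to be the identity.

    What remains is that if [|\sum_(j < n) phi_j(x_j)| <= c |x|_X(E)] for all
    [x] in [E^n], then [|\sum_(j < n) psi_j(phi_j)| <= c |psi|_X(E'')] for all
    [psi] in [E''^n].  By linear stability and finite injectivity,
    [|x|_X(E) <= B |psi|_X(E'')] as soon as
    [|\sum a_j x_j| <= B |\sum a_j psi_j|] for all scalars [a], and up to a
    small perturbation, which makes the [psi_j] linearly independent, it
    suffices to check finitely many [a], forming a net of the unit ball.
    Hahn-Banach on a finite power of [E] then gives the bound.  This replaces
    the principle of local reflexivity. *)

(* [Num.Def] shadows the truncation of sequences. *)
Local Notation trunc := Defs.trunc.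

(** * Real and complex scalars *)

(** Comparing [X(E)] with [X(E'')] goes through the map that sends each [psi j] to [x j]. It lives
    only on the span of the [psi j], whereas linear stability needs a Banach space as domain; finite
    injectivity says that the norm computed in [X] of the span does not exceed the one computed in
    [X(E'')]. Linear independence makes the map well defined. Finitely many [a] are used because
    functionals on a finite power of [E] are finite families in [E'], which can be paired with the
    [psi j]; an infinite power with a supremum norm has further functionals. Going back from a net
    to all [a] costs an additive error proportional to the l_1-norm of [a]. It becomes a factor
    [1 + ep] only if the norm of [\sum a_j psi_j] dominates a multiple of that l_1-norm, which is
    the second use of the perturbation. The norm of the dual class is a supremum of sums of moduli;
    spherical completeness turns them into pairings by rotating each coordinate. *)

Section Scalars.
Context {R : realType} {b : bool}.
Local Notation K := (scalars R b).

(** Norms take values in [scalars R b], whose order is partial when [b] is true. Suprema, monotone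
    limits and Zorn extensions are carried out in [R]; [ofR] and [toR] transport inequalities
    between nonnegative scalars. *)
Definition ofR : R -> K :=
  if b return R -> scalars R b then (fun r => real_complex R r) else (fun r => r).

Definition toR : K -> R :=
  if b return scalars R b -> R then (fun z => complex.Re z) else (fun z => z).
End Scalars.

Section ScalarsTheory.
Context {R : realType}.

Lemma ofR_le b (r s : R) : (ofR r <= ofR s :> scalars R b) = (r <= s).
Proof. by case: b => //=; exact: lecR. Qed.

Lemma ofR_lt b (r s : R) : (ofR r < ofR s :> scalars R b) = (r < s).
Proof. by case: b => //=; exact: ltcR. Qed.

Lemma ofRB b (r s : R) : ofR (r - s) = ofR r - ofR s :> scalars R b.
Proof. by case: b => //=; exact: rmorphB. Qed.

Lemma ofRD b (r s : R) : ofR (r + s) = ofR r + ofR s :> scalars R b.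
Proof. by case: b => //=; exact: rmorphD. Qed.

Lemma ofRM b (r s : R) : ofR (r * s) = ofR r * ofR s :> scalars R b.
Proof. by case: b => //=; exact: rmorphM. Qed.

Lemma ofR0 b : ofR 0 = 0 :> scalars R b.
Proof. by case: b. Qed.

Lemma ofR1 b : ofR 1 = 1 :> scalars R b.
Proof. by case: b. Qed.

Lemma ofR_nat b n : ofR n%:R = n%:R :> scalars R b.
Proof. by elim: n => [|n IH]; rewrite ?ofR0// -natr1 ofRD IH ofR1 natr1. Qed.

Lemma ofRK b (r : R) : toR (ofR r : scalars R b) = r.
Proof. by case: b. Qed.

Lemma toR1 b : toR (1 : scalars R b) = 1.
Proof. by rewrite -(ofR1 b) ofRK. Qed.

Lemma toRK b (z : scalars R b) : 0 <= z -> ofR (toR z) = z.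
Proof. by case: b z => //= z z0; apply: RRe_real; rewrite ger0_real. Qed.

Lemma toR_norm b (V : normedZmodType (scalars R b)) (z : V) : ofR (toR `|z|) = `|z|.
Proof. exact: toRK. Qed.

Lemma toR_ge0 b (z : scalars R b) : 0 <= z -> 0 <= toR z.
Proof. by move=> z0; rewrite -(ofR_le b) ofR0 toRK. Qed.

(** Nonnegative scalars are real, so the supremum can be taken in [R]. Competing bounds are
    restricted to nonnegative ones to match [is_opnorm] and [Xdual_normis]. *)
Lemma scal_lub b (S : set (scalars R b)) (M : scalars R b) :
  S !=set0 -> (forall x, S x -> 0 <= x) -> (forall x, S x -> x <= M) ->
  exists c, [/\ 0 <= c, forall x, S x -> x <= c &
    forall c', 0 <= c' -> (forall x, S x -> x <= c') -> c <= c'].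
Proof.
move=> [x0 Sx0] S0 SM; pose T := toR @` S.
have M0 : 0 <= M by exact: le_trans (S0 _ Sx0) (SM _ Sx0).
have ST : has_sup T.
  split; first by exists (toR x0), x0.
  exists (toR M) => _ [x Sx <-].
  rewrite -(ofR_le b) !toRK; [exact: SM|exact: M0|exact: S0].
have T0 : 0 <= sup T.
  apply: (@le_trans _ _ (toR x0)); first exact: toR_ge0 (S0 _ Sx0).
  by apply: (sup_upper_bound ST); exists x0.
exists (ofR (sup T)); split.
- by rewrite -(ofR0 b) ofR_le.
- move=> x Sx; rewrite -[x]toRK ?S0// ofR_le.
  by apply: (sup_upper_bound ST); exists x.
- move=> c' c'0 Hc'; rewrite -[c']toRK// ofR_le.
  apply: ge_sup; first by case: ST.
  by move=> _ [x Sx <-]; rewrite -(ofR_le b) !toRK; [exact: Hc'| |exact: S0].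
Qed.

Lemma scal_archi b (M : scalars R b) : 0 <= M -> exists n : nat, M < n%:R.
Proof.
move=> M0; exists (truncn (toR M)).+1.
have := truncnS_gt (toR M); move: (truncn _).+1 => n.
by rewrite -{2}[M]toRK// -ofR_nat ofR_lt.
Qed.

Definition norm_cauchy (K : numFieldType) (V : zmodType) (N : V -> K) (u : nat -> V) :=
  forall e : K, 0 < e -> exists n0, forall m n, (n0 <= m)%N -> (n0 <= n)%N ->
    N (u m - u n) < e.

Definition norm_cvg (K : numFieldType) (V : zmodType) (N : V -> K) (u : nat -> V) l :=
  forall e : K, 0 < e -> exists n0, forall n, (n0 <= n)%N -> N (u n - l) < e.

Lemma banach_seq_complete (K : numFieldType) (V : completeNormedModType K) (u : nat -> V) :
  norm_cauchy normr u -> exists l, norm_cvg normr u l.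
Proof.
move=> Hu; have /cauchy_cvg : cauchy (u @ \oo).
  apply/cauchy_exP => e e0; have [n0 Hn0] := Hu _ e0.
  exists (u n0); exists n0 => // n /= n0n; rewrite -ball_normE; exact: Hn0.
move=> /cvg_ex[l Hl]; exists l => e e0.
move/cvgrPdist_lt: Hl => /(_ _ e0)[n0 _ Hn0]; exists n0 => n n0n.
by rewrite distrC; exact: Hn0.
Qed.

Lemma normc_ge_Im (z : R[i]) : `|complex.Im z|%:C%C <= `|z|.
Proof.
have -> : complex.Im z = complex.Re (- z * 'i%C) by rewrite mulNr raddfN /= ReiNIm opprK.
apply: le_trans (normc_ge_Re _) _.
by rewrite normrM normrN [X in _ * X](_ : _ = 1) ?mulr1// normc_def /= expr0n expr1n add0r sqrtr1.
Qed.

Lemma normc_le_ReIm (z : R[i]) :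
  `|z| <= (`|complex.Re z| + `|complex.Im z|)%:C%C.
Proof.
rewrite {1}[z]complexE (le_trans (ler_normD _ _))// rmorphD/= lerD//.
  by rewrite normc_def /= expr0n addr0 sqrtr_sqr.
rewrite normrM [X in X * _](_ : _ = 1) ?mul1r; last first.
  by rewrite normc_def /= expr0n expr1n add0r sqrtr1.
by rewrite normc_def /= expr0n addr0 sqrtr_sqr.
Qed.

Lemma scal_complete b (u : nat -> scalars R b) :
  norm_cauchy normr u -> exists l, norm_cvg normr u l.
Proof.
case: b u => u; last exact: (@banach_seq_complete R R^o).
move=> Hu.
have [|l1 Hl1] := @banach_seq_complete R R^o (fun n => complex.Re (u n)).
  move=> e e0; have [|n0 Hn0] := Hu (e%:C)%C; first by rewrite ltcR.
  exists n0 => m n n0m n0n; rewrite -ltcR; apply: le_lt_trans (Hn0 m n n0m n0n).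
  by rewrite -raddfB; exact: normc_ge_Re.
have [|l2 Hl2] := @banach_seq_complete R R^o (fun n => complex.Im (u n)).
  move=> e e0; have [|n0 Hn0] := Hu (e%:C)%C; first by rewrite ltcR.
  exists n0 => m n n0m n0n; rewrite -ltcR; apply: le_lt_trans (Hn0 m n n0m n0n).
  by rewrite -raddfB; exact: normc_ge_Im.
exists (Complex l1 l2) => e e0.
have He : ((complex.Re e)%:C)%C = e by apply: RRe_real; rewrite ger0_real ?ltW.
have e20 : 0 < complex.Re e / 2 by rewrite divr_gt0// -ltcR He.
have [n1 Hn1] := Hl1 _ e20; have [n2 Hn2] := Hl2 _ e20.
exists (maxn n1 n2) => n; rewrite geq_max => /andP[n1n n2n].
apply: le_lt_trans (normc_le_ReIm _) _; rewrite -He ltcR.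
rewrite [complex.Re e]splitr ltrD// ?raddfB//=; [exact: Hn1|exact: Hn2].
Qed.

Lemma real_net (e : R) : 0 < e -> exists s : seq R, forall z, `|z| <= 1 ->
  exists2 w, w \in s & `|z - w| <= e.
Proof.
move=> e0; pose N := (truncn (e^-1)).+1.
have N0 : 0 < N%:R :> R by rewrite ltr0n.
have Ne : N%:R^-1 <= e.
  by rewrite invf_ple ?posrE//; exact/ltW/truncnS_gt.
(* A grid of mesh [1 / N <= e] on [[-1, 1]]; [z] is matched with the grid point just below it. *)
exists [seq k%:R / N%:R - 1 | k <- iota 0 (2 * N).+1] => z.
rewrite ler_norml => /andP[z1 z2].
have z0 : 0 <= (z + 1) * N%:R by apply: mulr_ge0 => //; lra.
have /andP[k1 k2] := truncn_itv z0; set k := truncn _ in k1 k2.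
exists (k%:R / N%:R - 1).
  apply/mapP; exists k => //; rewrite mem_iota add0n ltnS /=.
  rewrite -(ler_nat R) natrM; apply: le_trans k1 _.
  by apply: ler_wpM2r; [exact: ltW|rewrite -lerBrDr; apply: le_trans z2 _; lra].
have h1 : k%:R / N%:R <= z + 1 by rewrite ler_pdivrMr.
have h2 : z + 1 < k%:R / N%:R + N%:R^-1.
  have -> : k%:R / N%:R + N%:R^-1 = k.+1%:R / N%:R :> R by rewrite -natr1 mulrDl mul1r.
  by rewrite ltr_pdivlMr.
by rewrite ler_norml; apply/andP; split; lra.
Qed.

Lemma scal_net b (e : scalars R b) : 0 < e -> exists s : seq (scalars R b),
  forall z, `|z| <= 1 -> exists2 w, w \in s & `|z - w| <= e.
Proof.
case: b e => e; last exact: real_net.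
move=> e0.
have He : ((complex.Re e)%:C)%C = e by apply: RRe_real; rewrite ger0_real ?ltW.
have e20 : 0 < complex.Re e / 2 by rewrite divr_gt0// -ltcR He.
have [s Hs] := real_net e20.
exists [seq Complex x y | x <- s, y <- s] => z z1.
have [|x xs Hx] := Hs (complex.Re z); first by rewrite -lecR (le_trans (normc_ge_Re _)).
have [|y ys Hy] := Hs (complex.Im z); first by rewrite -lecR (le_trans (normc_ge_Im _)).
exists (Complex x y); first by apply: allpairs_f.
apply: le_trans (normc_le_ReIm _) _; rewrite -He lecR.
by rewrite [leRHS]splitr lerD ?raddfB.
Qed.

End ScalarsTheory.

(** * The Hahn-Banach theorem *)

Section HahnBanachReal.
Context {R : realType} (V : lmodType R) (p : V -> R).
Hypothesis pD : forall x y, p (x + y) <= p x + p y.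
Hypothesis pZ : forall (t : R) x, 0 < t -> p (t *: x) = t * p x.

(** Partial functionals are kept as graphs so that Zorn's lemma can be applied to inclusion;
    single-valuedness is left to follow from domination by [p]. *)
Definition dominated_graph (G : set (V * R)) : Prop :=
  [/\ G (0, 0),
      forall a v r w s, G (v, r) -> G (w, s) -> G (a *: v + w, a * r + s) &
      forall v r, G (v, r) -> r <= p v].

(** Two values over [v] put both [(0, s - r)] and [(0, r - s)] in the graph, and [p 0 = 0] bounds
    both differences by 0. *)
Lemma dominated_graph_fun G v r s : dominated_graph G ->
  G (v, r) -> G (v, s) -> r = s.
Proof.
move=> [G0 GD Gp] Gr Gs.
have p0 : p 0 = 0.
  by have := pZ 0 (ltr0n R 2); rewrite scaler0 => p0; lra.
have Grs : G (0, s - r).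
  by have := GD (-1) _ _ _ _ Gr Gs; rewrite scaleN1r addNr mulN1r addrC.
have Gsr : G (0, r - s).
  by have := GD (-1) _ _ _ _ Gs Gr; rewrite scaleN1r addNr mulN1r addrC.
by have := Gp _ _ Grs; have := Gp _ _ Gsr; rewrite p0; lra.
Qed.

(** The value [al] at [v0] must lie above every [r - p (v - v0)] and below every [p (w + v0) - s].
    Subadditivity puts the first family below the second, so its supremum works; scaling by [|t|^-1]
    then settles [v + t v0]. *)
Lemma dominated_graph_extend G v0 : dominated_graph G ->
  exists G', [/\ dominated_graph G', G `<=` G' & exists r, G' (v0, r)].
Proof.
move=> [G0 GD Gp].
have GZ a v r : G (v, r) -> G (a *: v, a * r).
  by move=> Gv; have := GD a _ _ _ _ Gv G0; rewrite !addr0.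
pose S := [set x.2 - p (x.1 - v0) | x in G].
have Sub w s : G (w, s) -> ubound S (p (w + v0) - s).
  move=> Gw _ [[v r] Gv <-] /=.
  have := GD 1 _ _ _ _ Gv Gw; rewrite scale1r mul1r => /Gp.
  have -> : v + w = (v - v0) + (w + v0) by rewrite addrACA addNr addr0.
  by move=> h; have := pD (v - v0) (w + v0); lra.
have supS : has_sup S.
  split; first by exists (0 - p (0 - v0)), (0, 0).
  by exists (p (0 + v0) - 0); exact: Sub.
pose al := sup S.
have al1 v r : G (v, r) -> r - p (v - v0) <= al.
  by move=> Gv; apply: (sup_upper_bound supS); exists (v, r).
have al2 v r : G (v, r) -> al <= p (v + v0) - r.
  by move=> Gv; apply: ge_sup; [case: supS|exact: Sub].
exists [set x | exists v r t, G (v, r) /\ x = (v + t *: v0, r + t * al)].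
split; last 2 first.
- by move=> [v r] Gv; exists v, r, 0; rewrite scale0r mul0r !addr0.
- by exists al; exists 0, 0, 1; rewrite scale1r mul1r !add0r.
split.
- by exists 0, 0, 0; rewrite scale0r mul0r !addr0.
- move=> a _ _ _ _ [v [r [t [Gv [-> ->]]]]] [w [s [t' [Gw [-> ->]]]]].
  exists (a *: v + w), (a * r + s), (a * t + t'); split; first exact: GD.
  congr pair; last by lra.
  by rewrite scalerDr scalerDl scalerA addrACA.
- move=> _ _ [v [r [t [Gv [-> ->]]]]].
  have [t0|t0|->] := ltgtP t 0; last 1 first.
  + by rewrite scale0r mul0r !addr0; exact: Gp.
  + have nt0 : 0 < - t by rewrite oppr_gt0.
    have := al1 _ _ (GZ (- t)^-1 _ _ Gv).
    have -> : (- t)^-1 *: v - v0 = (- t)^-1 *: (v + t *: v0).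
      by rewrite scalerDr scalerA invrN mulNr mulVf ?lt_eqF// scaleN1r.
    rewrite pZ ?invr_gt0// -mulrBr mulrC ler_pdivrMr//.
    by lra.
  + have := al2 _ _ (GZ t^-1 _ _ Gv).
    have -> : t^-1 *: v + v0 = t^-1 *: (v + t *: v0).
      by rewrite scalerDr scalerA mulVf ?gt_eqF// scale1r.
    rewrite pZ ?invr_gt0// -mulrBr [X in _ <= X]mulrC ler_pdivlMr//.
    by lra.
Qed.

Lemma dominated_graph_extend_all G0 : dominated_graph G0 ->
  (* The witness comes from Zorn's lemma applied to graphs [A] taken together with [G0]: joining
     [G0] lets the union of the empty chain qualify, and a maximal [A] is extended past [v] by the
     previous lemma. *)
  exists G, [/\ dominated_graph G, G0 `<=` G & forall v, exists r, G (v, r)].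
Proof.
move=> dG0; pose P (A : set (V * R)) := dominated_graph (A `|` G0).
have [F FP Ftot|A [PA Amax]] := @Zorn_bigcup _ P.
  have [[B0 FB0]|F0] := pselect (F !=set0); last first.
    rewrite /P (_ : _ `|` _ = G0)//; apply/seteqP; split; last by right.
    by move=> x [[B FB _]|//]; exfalso; apply: F0; exists B.
  have sub B : F B -> B `|` G0 `<=` \bigcup_(X in F) X `|` G0.
    by move=> FB x [Bx|]; [left; exists B|right].
  have common x y : (\bigcup_(X in F) X `|` G0) x -> (\bigcup_(X in F) X `|` G0) y ->
      exists B, [/\ F B, (B `|` G0) x & (B `|` G0) y].
    move=> [[B FB Bx]|Gx] [[C FC Cy]|Gy].
    - have [BC|CB] := Ftot _ _ FB FC.
        by exists C; split => //; left => //; exact: BC.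
      by exists B; split => //; left => //; exact: CB.
    - by exists B; split; [|left|right].
    - by exists C; split; [|right|left].
    - by exists B0; split => //; right.
  split.
  - by right; case: dG0.
  - move=> a v r w s /common H /H[B [FB Bv Bw]].
    by apply: (sub B FB); have [_ + _] := FP _ FB; apply.
  - by move=> v r H; have [B [FB Bv _]] := common _ _ H H; have [_ _] := FP _ FB; apply.
exists (A `|` G0); split => // v.
have [G' [dG' sub [r G'v]]] := dominated_graph_extend v PA.
have [AG'|] := pselect (G' `<=` A).
  by exists r; left; exact: AG'.
move=> nsub; exfalso; apply: (Amax G').
  by split=> // x Ax; apply: sub; left.
rewrite /P (_ : _ `|` _ = G')//; apply/seteqP; split; last by left.
by move=> x [//|G0x]; apply: sub; right.
Qed.

Theorem hahn_banach_real G0 : dominated_graph G0 ->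
  exists f : V -> R, [/\ forall a x y, f (a *: x + y) = a * f x + f y,
    forall x, f x <= p x & forall v r, G0 (v, r) -> f v = r].
Proof.
move=> /dominated_graph_extend_all[G [dG sub tot]].
have [f Hf] := choice tot.
exists f; split.
- move=> a x y; apply: (dominated_graph_fun dG (Hf _)).
  by have [_ + _] := dG; apply.
- by move=> x; have [_ _] := dG; apply.
- by move=> v r /sub; exact: dominated_graph_fun dG (Hf v).
Qed.

End HahnBanachReal.

Section Realification.
Context {R : realType} (V : lmodType R[i]).
(** A copy of [V] under another name, so that the real module structure does not compete with the
    complex one. *)
Definition realification : Type := V.
HB.instance Definition _ := GRing.Zmodule.on realification.
Definition real_scale (t : R) (v : realification) : realification := (t%:C%C : R[i]) *: (v : V).
Fact real_scaleA a c v : real_scale a (real_scale c v) = real_scale (a * c) v.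
Proof. by rewrite /real_scale scalerA rmorphM. Qed.
Fact real_scale1 : left_id 1 real_scale.
Proof. by move=> v; rewrite /real_scale scale1r. Qed.
Fact real_scaleDr : right_distributive real_scale +%R.
Proof. by move=> a v w; rewrite /real_scale scalerDr. Qed.
Fact real_scaleDl v : {morph real_scale^~ v : a c / a + c}.
Proof. by move=> a c; rewrite /real_scale rmorphD scalerDl. Qed.
HB.instance Definition _ := GRing.Zmodule_isLmodule.Build R realification
  real_scaleA real_scale1 real_scaleDr real_scaleDl.
End Realification.

Section HahnBanach.
Context {R : realType}.

(* The subspace and the functional on it are given by a linear map [A] and a
   functional [u] factoring through [A]. *)
Theorem hahn_banach b (U V : lmodType (scalars R b)) (A : U -> V) (u : U -> scalars R b)
    (p : V -> R) :
  (forall a x y, A (a *: x + y) = a *: A x + A y) ->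
  (forall a x y, u (a *: x + y) = a * u x + u y) ->
  (forall x y, p (x + y) <= p x + p y) ->
  (forall a x, p (a *: x) = toR `|a| * p x) ->
  (forall x, toR `|u x| <= p (A x)) ->
  exists f : V -> scalars R b, [/\ forall a x y, f (a *: x + y) = a * f x + f y,
    forall x, toR `|f x| <= p x & forall x, f (A x) = u x].
Proof.
case: b U V A u p => U V A u p AL uL pD pZ up.
- have u0 : u 0 = 0 by have := uL (-1) 0 0; rewrite scaler0 addr0 mulN1r addNr.
  have A0 : A 0 = 0 by have := AL (-1) 0 0; rewrite !scaler0 addr0 scaleN1r addNr.
  have uZ a x : u (a *: x) = a * u x by rewrite -[a *: x]addr0 uL u0 addr0.
  have Re_le (z : R[i]) : complex.Re z <= complex.Re `|z|.
    rewrite -lecR [X in _ <= X](RRe_real (normr_real z)).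
    by rewrite (le_trans _ (normc_ge_Re z))// lecR ler_norm.
  have dG : @dominated_graph R (realification V) p
      [set x | exists y, x = (A y, complex.Re (u y))].
    split.
    + by exists 0; rewrite u0 A0.
    + move=> a _ _ _ _ [x [-> ->]] [y [-> ->]].
      exists ((a%:C%C : R[i]) *: x + y); rewrite AL uL; congr pair.
      by case: (u x) (u y) => [x1 x2] [y1 y2] /=; rewrite mul0r subr0.
    + by move=> _ _ [x [-> ->]]; exact: le_trans (Re_le _) (up x).
  have [||g [gL gp gA]] := @hahn_banach_real R (realification V) p _ _ _ dG.
  + exact: pD.
  + move=> t x t0; have nt : complex.Re `|(t%:C)%C : R[i]| = t.
      by rewrite normc_def /= expr0n addr0 sqrtr_sqr gtr0_norm.
    by rewrite -[X in X * _]nt; exact: (pZ (t%:C%C : R[i]) x).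
  have gD x y : g (x + y) = g x + g y by have := gL 1 x y; rewrite scale1r mul1r.
  have g0 : g 0 = 0 by have := gD 0 0; rewrite addr0; lra.
  have gZ t (x : V) : g ((t%:C%C : R[i]) *: x) = t * g x.
    by have := gL t x 0; rewrite addr0 g0 addr0.
  have gN (x : V) : g (- x) = - g x by have := gD x (- x); rewrite subrr g0; lra.
  (* A complex-linear [f] with real part [g] has [Re (f (i v)) = - Im (f v)], which dictates the
     imaginary part. *)
  pose f (v : V) : R[i] := Complex (g v) (- g ('i%C *: v)).
  have fL (a : R[i]) x y : f (a *: x + y) = a * f x + f y.
    case: a => a1 a2; rewrite /f.
    have E1 : Complex a1 a2 *: x = (a1%:C)%C *: x + (a2%:C)%C *: ('i%C *: x).
      rewrite scalerA -scalerDl; congr (_ *: _).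
      by apply/eqP; rewrite eq_complex /=; apply/andP; split; apply/eqP; lra.
    have E2 : 'i%C *: (Complex a1 a2 *: x) = (a1%:C)%C *: ('i%C *: x) - (a2%:C)%C *: x.
      rewrite !scalerA -scalerBl; congr (_ *: _).
      by apply/eqP; rewrite eq_complex /=; apply/andP; split; apply/eqP; lra.
    rewrite scalerDr E2 E1 !gD gN !gZ.
    by apply/eqP; rewrite eq_complex /=; apply/andP; split; apply/eqP; lra.
  exists f; split => //.
  + move=> x; change (complex.Re `|f x| <= p x).
    have [->|fx0] := eqVneq (f x) 0.
      rewrite normr0 /=; have := pZ 0 x; rewrite scale0r normr0 mul0r => h.
      have := pD x (- x); have := pZ (-1) x.
      by rewrite scaleN1r normrN1 toR1 mul1r subrr h => ->; lra.
    (* Rotating [x] by [l] makes [f] real and nonnegative there, so the bound on [g] becomes a bound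
       on the modulus of [f]. *)
    pose l := `|f x| / f x.
    have l1 : `|l| = 1 by rewrite normrM normfV normr_id mulfV// normr_eq0.
    have E : f (l *: x) = `|f x|.
      have f0 : f 0 = 0 by rewrite /f scaler0 g0 oppr0.
      by rewrite -[l *: x]addr0 fL f0 addr0 /l mulfVK.
    have := gp (l *: x); have -> : g (l *: x) = complex.Re (f (l *: x)) by [].
    by rewrite E => /le_trans; apply; rewrite (pZ l x) l1 /= mul1r.
  + move=> x; have E y : g (A y) = complex.Re (u y) by apply: gA; exists y.
    have AZ a y : A (a *: y) = a *: A y by rewrite -[a *: y]addr0 AL A0 addr0.
    rewrite /f -AZ !E uZ.
    by case: (u x) => u1 u2; apply/eqP; rewrite eq_complex /=; apply/andP; split; apply/eqP; lra.
- have u0 : u 0 = 0 by have := uL (-1) 0 0; rewrite scaler0 addr0 mulN1r addNr.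
  have A0 : A 0 = 0 by have := AL (-1) 0 0; rewrite !scaler0 addr0 scaleN1r addNr.
  have dG : @dominated_graph R V p [set x | exists y, x = (A y, u y)].
    split.
    + by exists 0; rewrite u0 A0.
    + move=> a _ _ _ _ [x [-> ->]] [y [-> ->]].
      by exists (a *: x + y); rewrite AL uL.
    + by move=> _ _ [x [-> ->]]; exact: le_trans (ler_norm _) (up x).
  have [||f [fL fp fA]] := @hahn_banach_real R V p _ _ _ dG.
  + exact: pD.
  + by move=> t x t0; have := pZ t x => /= ->; rewrite gtr0_norm.
  exists f; split => // [x|x]; last by apply: fA; exists x.
  rewrite /= ler_norml fp andbT.
  have := fL (-1) x 0; have := fL 1 0 0; rewrite scale1r !addr0 scaleN1r => f0 fN.
  by have := fp (- x); have := pZ (-1) x; rewrite scaleN1r /= normrN1 mul1r => ->; lra.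
Qed.
End HahnBanach.

(** * Banach spaces from sequentially complete norms *)

Section Completeness.
Context {R : realType} {b : bool}.
Local Notation K := (scalars R b).

Lemma scal_inv_small (e : K) : 0 < e ->
  exists n0, forall n, (n0 <= n)%N -> n.+1%:R^-1 < e.
Proof.
move=> e0; have [|n0 Hn0] := @scal_archi R b e^-1; first by rewrite invr_ge0 ltW.
exists n0 => n n0n; rewrite invf_plt ?posrE ?ltr0n//.
by apply: lt_le_trans Hn0 _; rewrite ler_nat leqW.
Qed.

(** A Cauchy filter [F] contains a ball of each radius [1 / (n + 1)]. Any two of these meet, so the
    centres [c n] form a Cauchy sequence, whose limit is also that of [F]. *)
Lemma seq_complete_cvg (V : normedModType K) :
  (forall u : nat -> V, norm_cauchy normr u -> exists l, norm_cvg normr u l) ->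
  forall F : set_system V, ProperFilter F -> cauchy F -> cvg F.
Proof.
move=> Hc F FF /cauchyP CF.
have /choice[c Hc0] : forall n : nat, exists x : V, F (ball x (n.+1%:R^-1 : K)).
  by move=> n; apply: CF; rewrite invr_gt0 ltr0n.
have dist m n : `|c m - c n| < m.+1%:R^-1 + n.+1%:R^-1.
  have /filter_ex[x [xm xn]] : F (ball (c m) m.+1%:R^-1 `&` ball (c n) n.+1%:R^-1).
    exact: filterI.
  move: xm xn; rewrite -!ball_normE /ball_/= => xm xn.
  rewrite -(subrKA x); apply: le_lt_trans (ler_normD _ _) _.
  by rewrite ltrD// distrC.
have [e e0|l Hl] := Hc c.
  have [|n0 Hn0] := @scal_inv_small (e / 2); first by rewrite divr_gt0.
  exists n0 => m n n0m n0n; apply: lt_trans (dist m n) _.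
  by rewrite [e]splitr ltrD ?Hn0.
apply/cvg_ex; exists l; apply/cvgrPdist_lt => e e0.
have e20 : 0 < e / 2 by rewrite divr_gt0.
have [n0 Hn0] := @scal_inv_small _ e20; have [n1 Hn1] := Hl _ e20.
have F1 := Hc0 (maxn n0 n1).
apply: filterS F1 => x; rewrite -ball_normE /ball_/= => xc.
rewrite -(subrKA (c (maxn n0 n1))); apply: le_lt_trans (ler_normD _ _) _.
rewrite [e]splitr ltrD//; first by rewrite distrC Hn1// leq_maxr.
by apply: lt_trans xc _; rewrite Hn0// leq_maxl.
Qed.

End Completeness.

Section BanachOf.
Context {R : realType} {b : bool}.
Local Notation K := (scalars R b).
Context (V : lmodType K) (N : V -> K).
Hypothesis ND : forall x y, N (x + y) <= N x + N y.
Hypothesis NZ : forall (a : K) x, N (a *: x) = `|a| * N x.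
Hypothesis N0 : forall x, N x = 0 -> x = 0.
Hypothesis Nc : forall u, norm_cauchy N u -> exists l, norm_cvg N u l.

(** The four properties are arguments of the type itself, so that the structures declared on it can
    recover them. *)
Definition banach_carrier of (forall x y, N (x + y) <= N x + N y)
  & (forall (a : K) x, N (a *: x) = `|a| * N x) & (forall x, N x = 0 -> x = 0)
  & (forall u, norm_cauchy N u -> exists l, norm_cvg N u l) : Type := V.
Local Notation T := (banach_carrier ND NZ N0 Nc).

HB.instance Definition _ := GRing.Lmodule.on T.
HB.instance Definition _ := @Lmodule_isNormed.Build K T N ND NZ N0.
HB.instance Definition _ := Uniform_isComplete.Build T
  (@seq_complete_cvg R b T Nc).

Definition banach_of : completeNormedModType K := T.

End BanachOf.

(** * Limits of scalars and dual pairings *)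

Section LinearPackaging.
Context {K : numFieldType} {U V : lmodType K} (f : U -> V).
Hypothesis fL : forall a x y, f (a *: x + y) = a *: f x + f y.

Lemma linear_pack : exists g : {linear U -> V}, forall x, g x = f x.
Proof.
have fL' : linear f by exact: fL.
by exists (HB.pack_for {linear U -> V} f (GRing.isLinear.Build K U V *:%R f fL')).
Qed.
End LinearPackaging.

Section ScalarLimits.
Context {K : numFieldType}.

Lemma scalar_linear_sum (V : lmodType K) (f : V -> K) :
  (forall a x y, f (a *: x + y) = a * f x + f y) ->
  forall (I : Type) (r : seq I) (P : pred I) (F : I -> V),
    f (\sum_(i <- r | P i) F i) = \sum_(i <- r | P i) f (F i).
Proof.
move=> fL; have fD x y : f (x + y) = f x + f y by have := fL 1 x y; rewrite scale1r mul1r.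
have f0 : f 0 = 0 by have := fL (-1) 0 0; rewrite scaler0 addr0 mulN1r addNr.
by move=> I r P F; exact: (big_morph f fD f0).
Qed.

Lemma scalar_linear0 (V : lmodType K) (f : V -> K) :
  (forall a x y, f (a *: x + y) = a * f x + f y) -> f 0 = 0.
Proof. by move=> fL; have := fL (-1) 0 0; rewrite scaler0 addr0 mulN1r addNr. Qed.

Lemma scalar_linearZ (V : lmodType K) (f : V -> K) :
  (forall a x y, f (a *: x + y) = a * f x + f y) -> forall a x, f (a *: x) = a * f x.
Proof. by move=> fL a x; rewrite -[a *: x]addr0 fL (scalar_linear0 fL) addr0. Qed.

Lemma norm_cvgP (V : pseudoMetricNormedZmodType K) (u : nat -> V) (l : V) :
  norm_cvg normr u l <-> u @ \oo --> l.
Proof.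
split=> [H|/cvgrPdist_lt H e e0].
  apply/cvgrPdist_lt => e e0; have [n0 Hn0] := H _ e0; exists n0 => // n /= n0n.
  by rewrite distrC; exact: Hn0.
have [n0 _ Hn0] := H _ e0; exists n0 => n n0n; rewrite distrC; exact: Hn0.
Qed.

Lemma lipschitz_continuous (V W : pseudoMetricNormedZmodType K) (f : V -> W) (B : K) :
  0 <= B -> (forall x y, `|f x - f y| <= B * `|x - y|) -> continuous f.
Proof.
move=> B0 fB x; apply/cvgrPdist_lt => e e0.
have B1 : 0 < B + 1 by rewrite ltr_wpDl.
near=> y; apply: le_lt_trans (fB _ _) _.
apply: (@le_lt_trans _ _ ((B + 1) * `|x - y|)); first by rewrite ler_wpM2r// lerDl.
rewrite mulrC -ltr_pdivlMr//; near: y.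
by apply: cvgr_dist_lt; [exact: cvg_id|rewrite divr_gt0].
Unshelve. all: by end_near. Qed.

Lemma rotation (z : K) : exists2 l : K, `|l| = 1 & l * z = `|z|.
Proof.
have [->|z0] := eqVneq z 0; first by exists 1; rewrite ?normr1// normr0 mulr0.
exists (`|z| / z); last by rewrite mulfVK.
by rewrite normrM normfV normr_id mulfV// normr_eq0.
Qed.

Lemma nonneg_lt_all (z : K) : 0 <= z -> (forall e, 0 < e -> z < e) -> z = 0.
Proof.
move=> z0 Hz; apply/eqP; rewrite eq_le z0 andbT.
rewrite real_leNgt ?ger0_real// ?real0//; apply/negP => /Hz.
by rewrite ltxx.
Qed.

(** In [K] the scalars [l] and [w] need not be comparable beforehand, so [w <= l] is obtained from
    the closed condition that [l - w] equals its own norm. *)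
Lemma norm_cvg_ge (u : nat -> K) (l w : K) (n0 : nat) :
  norm_cvg normr u l -> (forall n, (n0 <= n)%N -> w <= u n) -> w <= l.
Proof.
move=> ul wu; rewrite -subr_ge0.
suff -> : l - w = `|l - w| by [].
apply/eqP; rewrite -subr_eq0 -normr_eq0; apply/eqP/nonneg_lt_all => // e e0.
have e20 : 0 < e / 2 by rewrite divr_gt0.
have [n1 Hn1] := ul _ e20; set n := maxn n0 n1.
have unw : `|u n - w| = u n - w by rewrite ger0_norm// subr_ge0 wu// leq_maxl.
have -> : l - w - `|l - w| = - (u n - l) + (`|u n - w| - `|l - w|).
  rewrite unw opprB addrA; congr (_ - _).
  by rewrite subrKA.
rewrite [e]splitr; apply: le_lt_trans (ler_normD _ _) _; rewrite normrN.
have h : `|u n - l| < e / 2 by rewrite Hn1// leq_maxr.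
apply: ltrD => //; apply: le_lt_trans h.
by apply: le_trans (ler_dist_dist _ _) _; rewrite opprB addrA subrK.
Qed.

Lemma norm_cvg_norm_le (V : normedZmodType K) (u : nat -> V) (l : V) (M : K) :
  norm_cvg normr u l -> 0 <= M -> (forall n, `|u n| <= M) -> `|l| <= M.
Proof.
move=> ul M0 uM; rewrite real_leNgt ?normr_real ?ger0_real//; apply/negP => Ml.
have [|n0 Hn0] := ul (`|l| - M); first by rewrite subr_gt0.
have := Hn0 _ (leqnn n0); rewrite ltrBrDr => h.
have : `|l| <= `|u n0 - l| + `|u n0|.
  by rewrite distrC -{1}[l](subrK (u n0)); exact: ler_normD.
move=> /le_lt_trans/(_ (le_lt_trans _ h)); rewrite ltxx => /(_ _)/negP.
by apply => //; rewrite lerD2l.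
Qed.

End ScalarLimits.

Section ScalarSeries.
Context {R : realType} {b : bool}.
Local Notation K := (scalars R b).

(** The sums of moduli are monotone and bounded, hence converge in [R]; their increments dominate
    those of the series, which is therefore Cauchy. *)
Lemma abs_bounded_series_cvg (z : nat -> K) (M : K) :
  (forall n, \sum_(0 <= j < n) `|z j| <= M) -> cvgn (series z).
Proof.
move=> zM; pose S n : K := \sum_(0 <= j < n) `|z j|.
have S0 n : 0 <= S n by apply: sumr_ge0.
have M0 : 0 <= M by exact: le_trans (S0 0%N) (zM 0%N).
have SB m n : (m <= n)%N -> S n - S m = \sum_(m <= j < n) `|z j|.
  by move=> mn; rewrite /S (big_cat_nat (n := m))//= addrAC subrr add0r.
have Smono m n : (m <= n)%N -> S m <= S n.
  by move=> mn; rewrite -subr_ge0 SB//; apply: sumr_ge0.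
pose T n := toR (S n).
have TS n : ofR (T n) = S n by rewrite toRK.
have : cvgn T.
  apply: nondecreasing_is_cvgn.
    by move=> m n mn; rewrite -(ofR_le b) !TS Smono.
  by exists (toR M) => _ [n _ <-]; rewrite -(ofR_le b) TS toRK//; exact: zM.
move=> /cvg_ex[t /norm_cvgP Ht].
have [|l Hl] := @scal_complete R b (series z).
  move=> e e0.
  have e2 : 0 < toR e / 2.
    by rewrite divr_gt0// -(ofR_lt b) ofR0 toRK// ltW.
  have [n0 Hn0] := Ht _ e2; exists n0.
  have key m n : (n0 <= m)%N -> (m <= n)%N -> `|series z n - series z m| < e.
    move=> n0m mn; have n0n := leq_trans n0m mn.
    rewrite sub_series_geq//; apply: le_lt_trans (ler_norm_sum _ _ _) _.
    rewrite -SB// -!TS -ofRB -[e]toRK ?ltW// ofR_lt.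
    have := Hn0 _ n0m; have := Hn0 _ n0n.
    by rewrite !ltr_norml => /andP[_ h1] /andP[h2 _]; lra.
  move=> m n n0m n0n; have [mn|/ltnW nm] := leqP m n; last exact: key.
  by rewrite distrC; exact: key.
by apply/cvg_ex; exists l; apply/norm_cvgP.
Qed.

End ScalarSeries.

Section DualPairing.
Context {R : realType} {b : bool}.
Local Notation K := (scalars R b).

Section Basic.
Context {E D : normedModType K} (ev : D -> E -> K).
Hypothesis dp : dual_pairing ev.

Lemma ev_linr d a x y : ev d (a *: x + y) = a * ev d x + ev d y.
Proof. by case: dp. Qed.

Lemma ev_linl x a d d' : ev (a *: d + d') x = a * ev d x + ev d' x.
Proof. by case: dp. Qed.

Lemma ev_le d x : `|ev d x| <= `|d| * `|x|.
Proof. by case: dp => _ _ /(_ d)[_ + _] _; apply. Qed.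

Lemma ev_norm_le d c : 0 <= c -> (forall x, `|ev d x| <= c * `|x|) -> `|d| <= c.
Proof. by case: dp => _ _ /(_ d)[_ _ +] _ c0 H; apply. Qed.

Lemma ev_inj d d' : (forall x, ev d x = ev d' x) -> d = d'.
Proof.
move=> H; apply/eqP; rewrite -subr_eq0 -normr_le0; apply: ev_norm_le => // x.
by rewrite mul0r addrC -scaleN1r ev_linl H mulN1r addNr normr0.
Qed.

Lemma dual_rep (f : E -> K) (c : K) : 0 <= c ->
  (forall a x y, f (a *: x + y) = a * f x + f y) -> (forall x, `|f x| <= c * `|x|) ->
  exists2 d, `|d| <= c & forall x, ev d x = f x.
Proof.
move=> c0 fL fc; case: dp => _ _ _ /(_ f fL)[|d Hd].
  apply: (lipschitz_continuous c0) => x y.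
  have -> : f x - f y = f (x - y) by rewrite [x - y]addrC -(scaleN1r y) fL mulN1r addrC.
  exact: fc.
by exists d => //; apply: ev_norm_le => // x; rewrite Hd.
Qed.

(** Hahn-Banach on the line through [v], parametrized by [a |-> a v], which also covers [v = 0]. *)
Lemma norm_attained (v : E) : exists2 d, `|d| <= 1 & ev d v = `|v|.
Proof.
have [a x y|a x y|x y|a x|x|f [fL fp fA]] := @hahn_banach R b (K^o) E
  (fun a => (a : K) *: v) (fun a => a * `|v|) (fun x => toR `|x|).
- by rewrite scalerDl scalerA.
- by rewrite mulrDl mulrA.
- by cbv beta; rewrite -(ofR_le b) ofRD !toR_norm ler_normD.
- by cbv beta; rewrite normrZ -[RHS](ofRK b) ofRM !toR_norm -normrZ -[RHS](ofRK b) toR_norm.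
- by cbv beta; rewrite normrM normr_id normrZ.
have [x|d d1 Hd] := @dual_rep f 1 ler01 fL.
  by rewrite mul1r -toR_norm -[leRHS]toR_norm ofR_le.
by exists d => //; rewrite Hd -(scale1r v) fA mul1r scale1r.
Qed.
End Basic.
End DualPairing.

(** * Sequence classes *)

Section BidualEmbedding.
Context {R : realType} {b : bool}.
Local Notation K := (scalars R b).
Context {E E1 E2 : completeNormedModType K} (ev1 : E1 -> E -> K) (ev2 : E2 -> E1 -> K).
Hypothesis dp1 : dual_pairing ev1.
Hypothesis dp2 : dual_pairing ev2.

Lemma bidual_embedding : exists i : {linear E -> E2},
  (forall x, `|i x| = `|x|) /\ (forall x d, ev2 (i x) d = ev1 d x).
Proof.
have /choice[i Hi] : forall x, exists j, `|j| <= `|x| /\ forall d, ev2 j d = ev1 d x.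
  move=> x; have [|a d d'|d|j jx Hj] := @dual_rep R b _ _ _ dp2 (ev1^~ x) `|x|.
  - exact: normr_ge0.
  - exact: ev_linl.
  - by rewrite mulrC; exact: ev_le.
  - by exists j.
have iL a x y : i (a *: x + y) = a *: i x + i y.
  apply: (ev_inj dp2) => d; rewrite (ev_linl dp2).
  by have [_ ->] := Hi (a *: x + y); have [_ ->] := Hi x; have [_ ->] := Hi y; exact: ev_linr.
have [g Hg] := linear_pack iL; exists g; split => [x|x d]; rewrite Hg; last by have [_ ->] := Hi x.
apply/eqP; rewrite eq_le; have [-> Hx] /= := Hi x.
have [d d1 Hd] := norm_attained dp1 x.
rewrite -[leLHS]normr_id -Hd -Hx; apply: le_trans (ev_le dp2 _ _) _.
by rewrite -[leRHS]mulr1 ler_wpM2l.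
Qed.

End BidualEmbedding.

Section SeqClassTheory.
Context {R : realType} {b : bool}.
Local Notation K := (scalars R b).
Context (X : @seqclass K).
Hypothesis hX : is_seqclass X.

Section Space.
Context (E : completeNormedModType K).
Local Notation S := (sc_mem X E).
Local Notation N := (sc_norm X E).
Implicit Types (x y : nat -> E).

Lemma sc_memL (a : K) x y : S x -> S y -> S (fun j => a *: x j + y j).
Proof. by have [[[_ +] _ _ _ _] _ _ _ _] := hX E; apply. Qed.

Lemma sc_mem0 : S (fun _ => 0).
Proof. by have [[[? _] _ _ _ _] _ _ _ _] := hX E. Qed.

Lemma sc_memZ (a : K) x : S x -> S (fun j => a *: x j).
Proof.
move=> Sx; have := sc_memL a Sx sc_mem0.
by congr sc_mem; apply/funext => j; rewrite addr0.
Qed.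

Lemma sc_memB x y : S x -> S y -> S (fun j => x j - y j).
Proof.
move=> Sx Sy; have := sc_memL (-1) Sy Sx.
by congr sc_mem; apply/funext => j; rewrite scaleN1r addrC.
Qed.

Lemma sc_norm_ge0 x : S x -> 0 <= N x.
Proof. by have [[_ + _ _ _] _ _ _ _] := hX E; apply. Qed.

Lemma sc_norm_eq0 x : S x -> N x = 0 -> x = (fun _ => 0).
Proof. by have [[_ _ [+ _] _ _] _ _ _ _] := hX E; apply. Qed.

Lemma sc_normZ (a : K) x : S x -> N (fun j => a *: x j) = `|a| * N x.
Proof. by have [[_ _ [_ +] _ _] _ _ _ _] := hX E; apply. Qed.

Lemma sc_normD x y : S x -> S y -> N (fun j => x j + y j) <= N x + N y.
Proof. by have [[_ _ _ + _] _ _ _ _] := hX E; apply. Qed.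

Lemma sc_norm0 : N (fun _ => 0) = 0.
Proof.
have := sc_normZ 0 sc_mem0; rewrite normr0 mul0r => <-.
by congr (N _); apply/funext => j; rewrite scaler0.
Qed.

Lemma sc_normBC x y : S x -> S y -> N (fun j => x j - y j) = N (fun j => y j - x j).
Proof.
move=> Sx Sy; rewrite -[LHS]mul1r -(normrN1 K) -sc_normZ; last exact: sc_memB.
by congr (N _); apply/funext => j; rewrite scaleN1r opprB.
Qed.

Lemma sc_mem_finsupp x : finsupp x -> S x.
Proof. by have [_ + _ _ _] := hX E; apply. Qed.

Lemma sc_coord_le x j : S x -> `|x j| <= N x.
Proof. by have [_ _ _ + _] := hX E; apply. Qed.

Lemma sc_norm_single (v : E) j : N (single v j) = `|v|.
Proof. by have [_ _ _ _ ->] := hX E. Qed.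

Lemma finsupp_trunc n x : finsupp (trunc n x).
Proof. by exists n => j nj; rewrite /Defs.trunc ltnNge nj. Qed.

Lemma sc_mem_trunc n x : S (trunc n x).
Proof. exact/sc_mem_finsupp/finsupp_trunc. Qed.

Lemma finsupp_single (v : E) j : finsupp (single v j).
Proof. by exists j.+1 => i ji; rewrite /single gtn_eqF. Qed.

Lemma sc_mem_single (v : E) j : S (single v j).
Proof. exact/sc_mem_finsupp/finsupp_single. Qed.

Lemma sc_complete (u : nat -> nat -> E) : (forall n, S (u n)) -> norm_cauchy N u ->
  exists2 l, S l & norm_cvg N u l.
Proof. by have [[_ _ _ _ +] _ _ _ _] := hX E; apply. Qed.

Lemma truncS n x : trunc n.+1 x = (fun j => trunc n x j + single (x n) n j).
Proof.
apply/funext => j; rewrite /Defs.trunc /single ltnS leq_eqVlt.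
by have [->|] := eqVneq j n; rewrite ?ltnn ?add0r ?addr0.
Qed.

End Space.

Section FinitelyDominated.
Hypothesis fd : finitely_dominated X.
Context (E : completeNormedModType K).
Local Notation S := (sc_mem X E).
Local Notation N := (sc_norm X E).
Implicit Types (x y : nat -> E).

Lemma sc_norm_trunc_le n x : S x -> N (trunc n x) <= N x.
Proof.
move=> Sx; have [Y [_ /(_ E) fY /(_ E)[[XY XYN _] _]]] := fd.
rewrite !XYN//; last exact: sc_mem_trunc.
have [_ /(_ (XY _ Sx))[+ _]] := fY x; apply.
by exists n.
Qed.

(* Since [Y] is finitely determined, the norm of a tail is the supremum of the
   norms of its segments, so (I) and (II) both say that the tails tend to 0. *)
Lemma sc_tail_lim0 x (e : K) : S x -> 0 < e -> exists n0, forall n, (n0 <= n)%N ->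
  N (fun j => x j - trunc n x j) < e.
Proof.
move=> Sx e0; have [Y [hY /(_ E) fY /(_ E)[[XY XYN _] HI]]] := fd.
have tailE n : (fun j => x j - trunc n x j) = tailseq n x.
  apply/funext => j; rewrite /Defs.trunc /tailseq [(n <= j)%N]leqNgt.
  by case: ifP; rewrite ?subrr ?subr0.
have St n : S (tailseq n x) by rewrite -tailE; apply: sc_memB => //; exact: sc_mem_trunc.
have Nt n : N (fun j => x j - trunc n x j) = sc_norm Y E (tailseq n x).
  by rewrite tailE XYN.
have t0 n : 0 <= sc_norm Y E (tailseq n x) by rewrite -XYN//; exact: sc_norm_ge0.
case: HI => HI; have [H _] := HI x (XY _ Sx).
  have [n0 Hn0] := H Sx e e0; exists n0 => n n0n.
  by rewrite Nt -[ltLHS]ger0_norm//; exact: Hn0.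
(* The tail norm is a supremum of segment norms, and strict bounds on the segments survive only as a
   large inequality; hence the halving. *)
have e20 : 0 < e / 2 by rewrite divr_gt0.
have [n0 Hn0] := H Sx _ e20; exists n0.+1 => n n0n.
rewrite Nt; apply: (@le_lt_trans _ _ (e / 2)); last by rewrite ltr_pdivrMr// ltr_pMr// ltr1n.
have [_ /(_ (XY _ (St n)))[_ +]] := fY (tailseq n x); apply => _ [m _ <-].
have [mn|nm] := leqP m n.
  have -> : trunc m (tailseq n x) = (fun _ => 0).
    apply/funext => j; rewrite /Defs.trunc /tailseq; case: ifP => // jm.
    by rewrite leqNgt (leq_trans jm mn).
  rewrite -XYN ?sc_norm0 ?ltW//; exact: sc_mem0.
have -> : trunc m (tailseq n x) = segseq n m.-1 x.
  apply/funext => j; rewrite /Defs.trunc /tailseq /segseq.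
  have -> : (j <= m.-1)%N = (j < m)%N by case: m nm.
  by case: (j < m)%N; rewrite ?andbT ?andbF.
rewrite -[leLHS]ger0_norm; first apply/ltW/Hn0.
- exact: leq_trans _ n0n.
- by case: m nm => // m nm /=; exact: leq_trans (ltnW n0n) _.
- have Sseg : S (segseq n m.-1 x).
    apply: sc_mem_finsupp => //; exists m => j mj; rewrite /segseq.
    by case: m nm mj => // m nm mj; rewrite /= [(j <= m)%N]leqNgt mj andbF.
  by rewrite -XYN//; exact: sc_norm_ge0.
Qed.

End FinitelyDominated.

Lemma sc_norm_linear (ls : linearly_stable X) (E F : completeNormedModType K)
    (T : {linear E -> F}) (B : K) : 0 <= B -> (forall v, `|T v| <= B * `|v|) ->
  forall x, sc_mem X E x -> sc_mem X F (T \o x) /\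
    sc_norm X F (T \o x) <= B * sc_norm X E x.
Proof.
move=> B0 TB x Sx.
have cT : continuous T by apply: (lipschitz_continuous B0) => v w; rewrite -linearB; exact: TB.
have [HT1 HT2] := ls E F T cT; split; first exact: HT1.
(* Linear stability speaks only of the exact operator norm of [T], which has to be constructed
   first, as a supremum of quotients; the value 0 keeps the set nonempty when [E] is trivial. *)
pose A := [set c | c = 0 \/ exists2 v, v != 0 & c = `|T v| / `|v|].
have [|c|c|c0 [c00 c0u c0l]] := @scal_lub R b A B.
- by exists 0; left.
- by move=> [->//|[v v0 ->]]; rewrite divr_ge0.
- by move=> [->//|[v v0 ->]]; rewrite ler_pdivrMr// normr_gt0.
have c0B : c0 <= B.
  by apply: c0l => // c [->//|[v v0 ->]]; rewrite ler_pdivrMr// normr_gt0.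
have [|_ + _] := HT2 c0.
  split => // [v _|c' c'0 Hc'].
    have [->|v0] := eqVneq v 0; first by rewrite linear0 !normr0 mulr0.
    by rewrite -ler_pdivrMr ?normr_gt0//; apply: c0u; right; exists v.
  apply: c0l => // _ [->//|[v v0 ->]]; rewrite ler_pdivrMr ?normr_gt0//.
  exact: Hc'.
move=> /(_ _ Sx) /le_trans; apply.
by apply: ler_wpM2r => //; exact: sc_norm_ge0.
Qed.

End SeqClassTheory.

(** * The norm of the dual class *)

Section DualNorm.
Context {R : realType} {b : bool}.
Local Notation K := (scalars R b).
Context (X : @seqclass K).
Hypothesis hX : is_seqclass X.
Hypothesis sph : spherically_complete X.
Context {G H : completeNormedModType K} (ev : H -> G -> K).
Hypothesis dp : dual_pairing ev.
Local Notation S := (sc_mem X H).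
Local Notation N := (sc_norm X H).

(** The form in which spherical completeness enters: a sum of moduli becomes a plain pairing with
    another sequence of the same norm. *)
Lemma rotate_pairing (psi : nat -> H) (x : nat -> G) : S psi ->
  exists psi', [/\ S psi', N psi' = N psi & forall j, ev (psi' j) (x j) = `|ev (psi j) (x j)|].
Proof.
move=> Spsi; have /choice[lam Hlam] : forall j, exists l : K, `|l| = 1 /\
    l * ev (psi j) (x j) = `|ev (psi j) (x j)|.
  by move=> j; have [l l1 Hl] := rotation (ev (psi j) (x j)); exists l.
have [S' N'] := sph Spsi (fun j => (Hlam j).1).
exists (fun j => lam j *: psi j); split => // j.
by have [_ <-] := Hlam j; exact: (scalar_linearZ (fun a d d' => ev_linl dp (x j) a d d')).
Qed.

Lemma sc_mem_geom_sum (psi : nat -> nat -> H) m : (forall k, S (psi k)) ->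
  S (fun j => \sum_(k < m) 2^-1 ^+ k *: psi k j).
Proof.
move=> Spsi; elim: m => [|m IH].
  by have := sc_mem0 hX H; congr sc_mem; apply/funext => j; rewrite big_ord0.
have := sc_memL hX (2^-1 ^+ m) (Spsi m) IH; congr sc_mem; apply/funext => j.
by rewrite big_ord_recr addrC.
Qed.

Lemma geom_series_cvg (psi : nat -> nat -> H) : (forall k, S (psi k)) ->
  (forall k, N (psi k) <= 1) ->
  exists2 l, S l & norm_cvg N (fun m j => \sum_(k < m) 2^-1 ^+ k *: psi k j) l.
Proof.
move=> Spsi Npsi; set u := fun m j => _.
have Su m : S (u m) by exact: sc_mem_geom_sum.
have ph : 0 < 2^-1 :> K by rewrite invr_gt0.
(* The right-hand side is [\sum_(m <= k < m + d) 2^-k] in closed form, so that the induction on [d]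
   telescopes. *)
have step m d : N (fun j => u (m + d)%N j - u m j) <= 2 * 2^-1 ^+ m - 2 * 2^-1 ^+ (m + d).
  elim: d => [|d IH].
    rewrite addn0 subrr (_ : (fun _ => _) = (fun _ => 0)) ?sc_norm0//.
    by apply/funext => j; rewrite subrr.
  rewrite (_ : (fun j => u (m + d.+1)%N j - u m j) =
    (fun j => (u (m + d)%N j - u m j) + 2^-1 ^+ (m + d) *: psi (m + d)%N j)); last first.
    by apply/funext => j; rewrite addnS /u big_ord_recr/= addrAC.
  have SB := sc_memB hX (Su (m + d)%N) (Su m).
  apply: le_trans (sc_normD hX SB (sc_memZ hX _ (Spsi _))) _.
  rewrite (sc_normZ hX)// (ger0_norm (exprn_ge0 _ (ltW ph))).
  apply: (@le_trans _ _ (2 * 2^-1 ^+ m - 2 * 2^-1 ^+ (m + d) + 2^-1 ^+ (m + d))).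
    apply: lerD => //; rewrite -[leRHS]mulr1 ler_wpM2l//; exact: exprn_ge0 (ltW ph).
  rewrite addnS exprS mulrA mulfV// mul1r -addrA lerD2l.
  by rewrite mulr2n mulrDl mul1r opprD -addrA addNr addr0.
have small (e : K) : 0 < e -> exists n0, forall m, (n0 <= m)%N -> 2 * 2^-1 ^+ m < e.
  move=> e0; have e20 : 0 < e / 2 by rewrite divr_gt0.
  have [n0 Hn0] := scal_inv_small e20; exists n0 => m n0m.
  rewrite mulrC -ltr_pdivlMr//; apply: le_lt_trans (Hn0 _ n0m).
  rewrite exprVn lef_pV2 ?posrE ?exprn_gt0 ?ltr0n//.
  by rewrite -natrX ler_nat; exact: ltn_expl.
apply: (sc_complete hX Su) => e e0; have [n0 Hn0] := small _ e0; exists n0.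
have key m n : (n0 <= m)%N -> (m <= n)%N -> N (fun j => u n j - u m j) < e.
  move=> n0m mn; rewrite -(subnKC mn); apply: le_lt_trans (step _ _) _.
  apply: le_lt_trans (Hn0 _ n0m); rewrite gerBl mulr_ge0//; exact: exprn_ge0 (ltW ph).
move=> m n n0m n0n; have [mn|/ltnW nm] := leqP m n; last exact: key.
by have := key _ _ n0m mn; rewrite (sc_normBC hX).
Qed.

(* If the sums were unbounded, unit vectors [psi k] with pairing sums larger than
   [4 ^ k] could be rotated so that all their pairings with [x] are nonnegative;
   then nothing cancels in [\sum_k 2 ^- k psi k], whose pairing sums diverge. *)
Lemma Xdual_bounded (x : nat -> G) : Xdual_mem X ev x ->
  exists M : K, forall psi, S psi -> N psi <= 1 ->
    forall n, \sum_(0 <= j < n) `|ev (psi j) (x j)| <= M.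
Proof.
move=> Hx; apply: contrapT => /forallNP HM.
have /choice[w Hw] : forall k : nat, exists w : (nat -> H) * nat,
    [/\ S w.1, N w.1 <= 1, (forall j, 0 <= ev (w.1 j) (x j)) &
     (4 ^+ k : K) < \sum_(0 <= j < w.2) ev (w.1 j) (x j)].
  move=> k; have := HM (4 ^+ k) => /existsNP[psi /not_implyP[Spsi /not_implyP[N1 /existsNP[n Hn]]]].
  have [psi' [S' N' E']] := rotate_pairing x Spsi.
  exists (psi', n); split => /=; rewrite ?N'//.
    by move=> j; rewrite E'.
  under eq_bigr do rewrite E'.
  move/negP: Hn; rewrite -real_ltNge ?ger0_real ?sumr_ge0 ?exprn_ge0//.
have Sw k : S (w k).1 by have [] := Hw k.
have Nw k : N (w k).1 <= 1 by have [] := Hw k.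
have [l Sl Hl] := geom_series_cvg Sw Nw.
pose u m j := \sum_(i < m) 2^-1 ^+ i *: (w i).1 j.
have evlin j := fun a d d' => ev_linl dp (x j) a d d'.
have ph n : 0 <= 2^-1 ^+ n :> K by rewrite exprn_ge0// invr_ge0.
(* All terms of the pairing with the partial sums are nonnegative, so each one bounds the total from
   below; this passes to [l] because [N] dominates every coordinate. *)
have low k j : 2^-1 ^+ k * ev ((w k).1 j) (x j) <= ev (l j) (x j).
  have evu m : ev (u m j) (x j) = \sum_(i < m) 2^-1 ^+ i * ev ((w i).1 j) (x j).
    rewrite (scalar_linear_sum (evlin j)).
    by apply: eq_bigr => i _; rewrite (scalar_linearZ (evlin j)).
  apply: (@norm_cvg_ge _ (fun m => ev (u m j) (x j)) _ _ k.+1); last first.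
    move=> m km; rewrite evu (bigD1 (Ordinal km))//= lerDl; apply: sumr_ge0 => i _.
    by apply: mulr_ge0; [exact: ph|have [_ _ + _] := Hw i; apply].
  move=> e e0; have x1 : 0 < `|x j| + 1 by rewrite ltr_wpDl.
  have [|n0 Hn0] := Hl (e / (`|x j| + 1)); first by rewrite divr_gt0.
  exists n0 => n n0n; have -> : ev (u n j) (x j) - ev (l j) (x j) = ev (u n j - l j) (x j).
    by rewrite [u n j - _]addrC -(scaleN1r (l j)) (ev_linl dp) mulN1r addrC.
  apply: le_lt_trans (ev_le dp _ _) _.
  apply: (@le_lt_trans _ _ (`|u n j - l j| * (`|x j| + 1))); first by rewrite ler_wpM2l// lerDl.
  rewrite -ltr_pdivlMr//; apply: le_lt_trans (Hn0 _ n0n).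
  apply: (@sc_coord_le _ _ _ hX H (fun j => u n j - l j) j).
  exact: (sc_memB hX (@sc_mem_geom_sum (fun i => (w i).1) n Sw) Sl).
have l0 j : 0 <= ev (l j) (x j).
  by apply: le_trans (low 0%N j); apply: mulr_ge0; [exact: ph|have [_ _ + _] := Hw 0%N; apply].
have /cvg_ex[L /norm_cvgP HL] := Hx l Sl.
have [n0 Hn0] := HL 1 ltr01.
(* Far out, the partial sums of the pairing with [l] are within 1 of [L], yet by [low] they exceed
   [2^-k 4^k = 2^k]. *)
have bnd k : (2 ^+ k : K) < `|L| + 1.
  have [_ _ w0 wk] := Hw k; pose n := maxn n0 (w k).2.
  have le1 : \sum_(0 <= j < n) ev (l j) (x j) <= `|L| + 1.
    rewrite -[leLHS]ger0_norm; last by apply: sumr_ge0 => j _; exact: l0.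
    rewrite -(subrK L (\sum_(_ <= _ < _) _)) addrC; apply: le_trans (ler_normD _ _) _.
    by rewrite lerD2l ltW// Hn0// leq_maxl.
  apply: lt_le_trans le1.
  apply: (@lt_le_trans _ _ (2^-1 ^+ k * \sum_(0 <= j < (w k).2) ev ((w k).1 j) (x j))).
    have -> : 2 ^+ k = 2^-1 ^+ k * 4 ^+ k :> K.
      by rewrite -exprMn; congr (_ ^+ k); rewrite (natrM _ 2 2) mulrA mulVf// mul1r.
    by rewrite ltr_pM2l// exprn_gt0// invr_gt0.
  rewrite mulr_sumr (@big_cat_nat _ _ _ (w k).2 0%N n)//=; last exact: leq_maxr.
  apply: (@le_trans _ _ (\sum_(0 <= j < (w k).2) ev (l j) (x j))).
    by apply: ler_sum => j _; exact: low.
  by rewrite lerDl; apply: sumr_ge0 => j _; exact: l0.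
have [|n Hn] := @scal_archi R b (`|L| + 1); first by rewrite addr_ge0.
have := lt_trans (bnd n) Hn; rewrite -natrX ltr_nat.
by rewrite ltnNge ltnW// ltn_expl.
Qed.

Lemma Xdual_norm_ex (x : nat -> G) : Xdual_mem X ev x -> exists c, Xdual_normis X ev x c.
Proof.
move=> /Xdual_bounded[M HM].
pose A := [set s : K | exists psi n, [/\ S psi, N psi <= 1 &
  s = \sum_(0 <= j < n) `|ev (psi j) (x j)|]].
have [|c|c|c [c0 cu cl]] := @scal_lub R b A M.
- by exists 0, (fun=> 0), 0%N; rewrite big_geq// (sc_norm0 hX); split=> //; exact: sc_mem0.
- by move=> [psi [n [_ _ ->]]]; apply: sumr_ge0.
- by move=> [psi [n [Spsi N1 ->]]]; exact: HM.
exists c; split=> // [psi Spsi N1 n|c' c'0 Hc'].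
  by apply: cu; exists psi, n.
by apply: cl => // _ [psi [n [Spsi N1 ->]]]; exact: Hc'.
Qed.

Lemma Xdual_norm_le (x : nat -> G) c : Xdual_normis X ev x c ->
  forall psi, S psi -> forall n, \sum_(0 <= j < n) `|ev (psi j) (x j)| <= c * N psi.
Proof.
move=> [c0 Hc _] psi Spsi n.
have evlin j := fun a d d' => ev_linl dp (x j) a d d'.
have [N0|N0] := eqVneq (N psi) 0.
  rewrite N0 mulr0 (sc_norm_eq0 hX Spsi N0) big1// => j _.
  by rewrite (scalar_linear0 (evlin j)) normr0.
have Np : 0 < N psi by rewrite lt_neqAle eq_sym N0 (sc_norm_ge0 hX).
have Ni : 0 <= (N psi)^-1 by rewrite invr_ge0 ltW.
have N1 : N (fun j => (N psi)^-1 *: psi j) <= 1.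
  by rewrite (sc_normZ hX)// (ger0_norm Ni) mulVf.
have := Hc _ (sc_memZ hX _ Spsi) N1 n.
rewrite -ler_pdivrMr// mulrC mulr_sumr; congr (_ <= _).
by apply: eq_bigr => j _; rewrite (scalar_linearZ (evlin j)) normrM (ger0_norm Ni).
Qed.

End DualNorm.

(** * A Helly-type lemma *)

Section Helly.
Context {R : realType} {b : bool}.
Local Notation K := (scalars R b).

Lemma toR_le (x y : K) : 0 <= x -> 0 <= y -> (toR x <= toR y) = (x <= y).
Proof. by move=> x0 y0; rewrite -(ofR_le b) !toRK. Qed.

Lemma toRM (x y : K) : 0 <= x -> 0 <= y -> toR (x * y) = toR x * toR y.
Proof. by move=> x0 y0; rewrite -[RHS](ofRK b) ofRM !toRK. Qed.

Lemma toRD (x y : K) : 0 <= x -> 0 <= y -> toR (x + y) = toR x + toR y.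
Proof. by move=> x0 y0; rewrite -[RHS](ofRK b) ofRD !toRK. Qed.

Lemma le_affine_eps (z M C : K) : z \is Num.real -> M \is Num.real -> 0 <= C ->
  (forall e, 0 < e -> e <= 1 -> z <= M + e * C) -> z <= M.
Proof.
move=> zr Mr C0 H; rewrite real_leNgt//; apply/negP => Mz.
have d0 : 0 < z - M by rewrite subr_gt0.
(* Being at least [z - M] and larger than [C], [D] makes [e = (z - M) / D] admissible while
   [e C < z - M]. *)
pose D := C + (z - M) + 1.
have CD : C < D by rewrite /D -addrA ltrDl ltr_wpDl// ltW.
have D0 : 0 < D by exact: le_lt_trans CD.
have zD : z - M <= D by rewrite /D addrAC lerDr addr_ge0.
have := H ((z - M) / D); rewrite divr_gt0// ler_pdivrMr// mul1r => /(_ erefl zD).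
rewrite -lerBlDl mulrAC ler_pdivlMr// ler_pM2l// => h.
by have := lt_le_trans CD h; rewrite ltxx.
Qed.

Context {E E1 E2 : completeNormedModType K} (ev1 : E1 -> E -> K) (ev2 : E2 -> E1 -> K).
Hypothesis dp1 : dual_pairing ev1.
Hypothesis dp2 : dual_pairing ev2.

Lemma norm_approx (d : E1) (e : K) : 0 < e -> exists2 v, `|v| <= 1 & `|d| - e <= ev1 d v.
Proof.
move=> e0; have [de|ed] := real_leP (normr_real d) (gtr0_real e0).
  exists 0; first by rewrite normr0.
  by rewrite (scalar_linear0 (fun a x y => ev_linr dp1 d a x y)) subr_le0.
have c0 : 0 < `|d| - e by rewrite subr_gt0.
have /existsNP[v /negP Hv] : ~ forall v, `|ev1 d v| <= (`|d| - e) * `|v|.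
  by move=> /(ev_norm_le dp1 (ltW c0)); rewrite lerDl oppr_ge0 => /(lt_le_trans e0); rewrite ltxx.
have v0 : 0 < `|v|.
  rewrite normr_gt0; apply/eqP => v0; move: Hv.
  by rewrite v0 (scalar_linear0 (fun a x y => ev_linr dp1 d a x y)) !normr0 mulr0 lexx.
have [l l1 Hl] := rotation (ev1 d v).
exists ((l / `|v|) *: v).
  by rewrite normrZ normrM l1 mul1r normfV normr_id mulVf ?gt_eqF.
rewrite (scalar_linearZ (fun a x y => ev_linr dp1 d a x y)) mulrAC Hl ler_pdivlMr// ltW//.
by rewrite real_ltNge ?realM ?normr_real// gtr0_real.
Qed.

(* Hahn-Banach on [E ^ I], normed by [max_i |z i| / w i],
   writes [phi j] as [\sum_i a i j d i] with [\sum_i w i |d i| <= M]. *)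
Lemma helly (I : finType) (n : nat) (a : I -> nat -> K) (w : I -> K) (M : K)
    (phi : nat -> E1) (psi : nat -> E2) :
  (forall i, 0 < w i) -> 0 <= M ->
  (forall i, `|\sum_(j < n) a i j *: psi j| <= w i) ->
  (forall (x : nat -> E) s, 0 <= s ->
     (forall i, `|\sum_(j < n) a i j *: x j| <= s * w i) ->
     `|\sum_(j < n) ev1 (phi j) (x j)| <= M * s) ->
  `|\sum_(j < n) ev2 (psi j) (phi j)| <= M.
Proof.
move=> w0 M0 psiw HM.
pose A (x : nat -> E) : I -> E := fun i => \sum_(j < n) a i j *: x j.
pose u (x : nat -> E) : K := \sum_(j < n) ev1 (phi j) (x j).
pose m (z : I -> E) : R := \big[Num.max/0]_i toR (`|z i| / w i).
have lin1 d := fun c x y => ev_linr dp1 d c x y.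
have wi0 i (y : E) : 0 <= `|y| / w i by rewrite divr_ge0// ltW.
have m0 z : 0 <= m z by apply: bigmax_ge_id.
have [c x y|c x y|z z'|c z|x|f [fL fp fA]] :=
  @hahn_banach R b (nat -> E) (I -> E) A u (fun z => toR M * m z).
- apply/funext => i; transitivity (c *: A x i + A y i) => //.
  rewrite /A scaler_sumr -big_split/=; apply: eq_bigr => j _.
  by rewrite scalerDr !scalerA [c * _]mulrC.
- by rewrite /u mulr_sumr -big_split/=; apply: eq_bigr => j _; exact: ev_linr.
- rewrite -mulrDr; apply: ler_wpM2l; first exact: toR_ge0.
  apply: bigmax_le => [|i _]; first by rewrite addr_ge0.
  apply: (@le_trans _ _ (toR (`|z i| / w i) + toR (`|z' i| / w i))); last first.
    by apply: lerD; exact: (le_bigmax _ (fun i => toR (_ / w i))).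
  rewrite -toRD// toR_le ?addr_ge0// -mulrDl ler_wpM2r ?ler_normD//.
  by rewrite invr_ge0 ltW.
- rewrite mulrCA; congr (_ * _).
  have cge0 : 0 <= toR `|c| by exact: toR_ge0.
  rewrite /m (big_morph (fun r => toR `|c| * r) (id1 := 0) (op1 := Num.max)); last 2 first.
  + by move=> r s; rewrite maxr_pMr.
  + by rewrite mulr0.
  apply: eq_bigr => i _; rewrite -toRM//; congr toR.
  by rewrite /= normrZ mulrA.
(* The hypothesis [HM] is applied with [s = m (A x)], the smallest [s] for which [x] meets all the
   constraints. *)
- rewrite -(ofR_le b) toR_norm ofRM toRK//; apply: HM.
    by rewrite -(ofR0 b) ofR_le.
  move=> i; rewrite -ler_pdivrMr//.
  by rewrite -[leLHS]toRK// ofR_le; exact: (le_bigmax _ (fun i => toR (`|A x i| / w i))).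
pose sg i (v : E) : I -> E := fun k => if k == i then v else 0.
have /choice[d Hd] : forall i, exists d, forall v, ev1 d v = f (sg i v).
  move=> i; have [||v|d _ Hd] := @dual_rep R b _ _ _ dp1 (fun v => f (sg i v)) (M / w i).
  - by rewrite divr_ge0// ltW.
  - move=> c x y; rewrite -fL; congr f; apply/funext => k; rewrite /sg /=.
    have -> : (c *: (fun k => if k == i then x else 0) + (fun k => if k == i then y else 0)) k
      = c *: (if k == i then x else 0) + (if k == i then y else 0) by [].
    by case: ifP; rewrite ?scaler0 ?addr0.
  - rewrite -[leLHS]toR_norm mulrAC -mulrA -[leRHS]toRK; last exact: mulr_ge0.
    rewrite ofR_le; apply: le_trans (fp _) _; rewrite toRM//.
    apply: ler_wpM2l; first exact: toR_ge0.
    apply: bigmax_le => [|k _]; first exact: toR_ge0.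
    rewrite toR_le// /sg; case: eqP => [->//|_]; by rewrite normr0 mul0r.
  - by exists d.
have fE z : f z = \sum_i ev1 (d i) (z i).
  have -> : z = \sum_i sg i (z i).
    apply/funext => k; rewrite fct_sumE (bigD1 k)//= /sg eqxx big1 ?addr0// => i.
    by rewrite eq_sym => /negbTE ->.
  rewrite (scalar_linear_sum fL); apply: eq_bigr => i _; rewrite Hd.
  congr (f (sg i _)); rewrite fct_sumE (bigD1 i)//= /sg eqxx big1 ?addr0// => k.
  by rewrite eq_sym => /negbTE ->.
(* The identity [f (A x) = u x] is tested on sequences with the single entry [v] at position [j]. *)
have phiE (j : 'I_n) : phi j = \sum_i a i j *: d i.
  apply: (ev_inj dp1) => v.
  rewrite (scalar_linear_sum (fun c d d' => ev_linl dp1 v c d d')).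
  have := fA (fun k => if k == j :> nat then v else 0).
  rewrite /u (bigD1 j)//= eqxx big1 ?addr0 => [<-|k kj]; last first.
    rewrite ifF; last exact: negbTE.
    exact: scalar_linear0 (lin1 _).
  rewrite fE; apply: eq_bigr => i _.
  rewrite (scalar_linearZ (fun c d d' => ev_linl dp1 v c d d')).
  rewrite /A (bigD1 j)//= eqxx big1 ?addr0 => [|k kj]; last first.
    by rewrite ifF ?scaler0//; exact: negbTE.
  exact: (scalar_linearZ (lin1 _)).
(* Evaluate [f] at the family [w i v i], where each [v i] lies in the unit ball and nearly norms
   [d i]: this family has [m] at most 1, so [f] is at most [M] there. *)
have wd : \sum_i w i * `|d i| <= M.
  have W0 : 0 <= \sum_i w i by apply: sumr_ge0 => i _; exact: ltW.
  apply: (le_affine_eps _ _ W0).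
  - by apply/ger0_real/sumr_ge0 => i _; rewrite mulr_ge0// ltW.
  - exact: ger0_real.
  move=> e e0 _.
  have /choice[v Hv] : forall i, exists v, `|v| <= 1 /\ `|d i| - e <= ev1 (d i) v.
    by move=> i; have [v v1 Hv] := norm_approx (d i) e0; exists v.
  rewrite mulr_sumr -lerBlDr -sumrB.
  apply: (@le_trans _ _ (f (fun i => w i *: v i))).
    rewrite fE; apply: ler_sum => i _; rewrite (scalar_linearZ (lin1 _)).
    rewrite [e * _]mulrC -mulrBr; apply: ler_wpM2l; first exact: ltW.
    by have [] := Hv i.
  apply: (@le_trans _ _ `|f (fun i => w i *: v i)|).
    apply: real_ler_norm; rewrite fE; apply: sum_real => i _.
    rewrite (scalar_linearZ (lin1 _)); apply: realM; first exact: gtr0_real.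
    have [_ h] := Hv i; have := ger0_real (_ : 0 <= ev1 (d i) (v i) - (`|d i| - e)).
    rewrite subr_ge0 => /(_ h) h'.
    rewrite -(subrK (`|d i| - e) (ev1 (d i) (v i))) realD//.
    by apply: realB; [exact: normr_real|exact: gtr0_real].
  rewrite -toR_norm -[leRHS]toRK// ofR_le; apply: le_trans (fp _) _.
  rewrite -[leRHS]mulr1; apply: ler_wpM2l; first exact: toR_ge0.
  apply: bigmax_le => // i _; rewrite -(@toR1 R b) toR_le//.
  rewrite ler_pdivrMr// mul1r normrZ (gtr0_norm (w0 i)) -[leRHS]mulr1.
  by apply: ler_wpM2l; [exact: ltW|have [] := Hv i].
apply: le_trans wd.
(* Substituting [phiE] and exchanging the sums lets the [d i] meet the combinations of the [psi j]
   that are bounded by [w i]. *)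
have -> : \sum_(j < n) ev2 (psi j) (phi j) = \sum_i ev2 (\sum_(j < n) a i j *: psi j) (d i).
  under eq_bigr => j _.
    rewrite phiE (scalar_linear_sum (fun c x y => ev_linr dp2 (psi j) c x y)).
    over.
  rewrite exchange_big/=; apply: eq_bigr => i _.
  rewrite (scalar_linear_sum (fun c x y => ev_linl dp2 (d i) c x y)).
  apply: eq_bigr => j _.
  rewrite (scalar_linearZ (fun c x y => ev_linr dp2 (psi j) c x y)).
  by rewrite (scalar_linearZ (fun c x y => ev_linl dp2 (d i) c x y)).
apply: le_trans (ler_norm_sum _ _ _) _; apply: ler_sum => i _.
by apply: le_trans (ev_le dp2 _ _) _; rewrite ler_wpM2r.
Qed.

End Helly.

(** * Norms on spaces of coefficients *)

Section RowSpaces.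
Context {R : realType} {b : bool}.
Local Notation K := (scalars R b).
Context (n : nat).

Definition row_norm (a : 'rV[K]_n) : K := \sum_(j < n) `|a 0 j|.

Lemma row_norm_ge0 a : 0 <= row_norm a.
Proof. exact: sumr_ge0. Qed.

Lemma row_normD x y : row_norm (x + y) <= row_norm x + row_norm y.
Proof. by rewrite /row_norm -big_split; apply: ler_sum => j _; rewrite mxE ler_normD. Qed.

Lemma row_normZ c x : row_norm (c *: x) = `|c| * row_norm x.
Proof. by rewrite /row_norm mulr_sumr; apply: eq_bigr => j _; rewrite mxE normrM. Qed.

Lemma row_norm_coord (x : 'rV[K]_n) j : `|x 0 j| <= row_norm x.
Proof. by rewrite /row_norm (bigD1 j)//= lerDl sumr_ge0. Qed.

Lemma row_norm_eq0 x : row_norm x = 0 -> x = 0.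
Proof.
move=> x0; apply/rowP => j; rewrite mxE; apply/eqP; rewrite -normr_le0 -x0.
exact: row_norm_coord.
Qed.

Lemma row_norm_complete (u : nat -> 'rV[K]_n) :
  norm_cauchy row_norm u -> exists l, norm_cvg row_norm u l.
Proof.
move=> Hu.
have /choice[l Hl] : forall j : 'I_n, exists l, norm_cvg normr (fun m => u m 0 j) l.
  move=> j; apply: scal_complete => e e0; have [n0 Hn0] := Hu _ e0; exists n0 => p q np nq.
  apply: le_lt_trans (Hn0 _ _ np nq); have := row_norm_coord (u p - u q) j.
  by rewrite !mxE.
exists (\row_j l j) => e e0.
have en : 0 < e / n.+1%:R by rewrite divr_gt0// ltr0n.
have /choice[N HN] : forall j : 'I_n, exists n0, forall m, (n0 <= m)%N ->
    `|u m 0 j - l j| < e / n.+1%:R.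
  by move=> j; exact: Hl.
exists (\max_j N j)%N => m Nm.
apply: (@le_lt_trans _ _ (\sum_(j < n) e / n.+1%:R)).
  apply: ler_sum => j _; rewrite !mxE ltW// HN//.
  exact: leq_trans (leq_bigmax j) Nm.
rewrite sumr_const card_ord -(mulr_natr (e / n.+1%:R)) mulrAC ltr_pdivrMr ?ltr0n//.
by rewrite ltr_pM2l// ltr_nat.
Qed.

Lemma equivalent_norm_complete (q : 'rV[K]_n -> K) (d C : K) : 0 < d -> 0 <= C ->
  (forall a, d * row_norm a <= q a) -> (forall a, q a <= C * row_norm a) ->
  forall u, norm_cauchy q u -> exists l, norm_cvg q u l.
Proof.
move=> d0 C0 dq qC u Hu; have [e e0|l Hl] := @row_norm_complete u.
  have [|n0 Hn0] := Hu (d * e); first exact: mulr_gt0.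
  exists n0 => p r n0p n0r; rewrite -(ltr_pM2l d0).
  exact: le_lt_trans (dq _) (Hn0 _ _ n0p n0r).
have C1 : 0 < C + 1 by rewrite ltr_wpDl.
exists l => e e0; have [|n0 Hn0] := Hl (e / (C + 1)); first by rewrite divr_gt0.
exists n0 => m n0m; apply: le_lt_trans (qC _) _.
apply: (@le_lt_trans _ _ ((C + 1) * row_norm (u m - l))).
  by rewrite ler_wpM2r ?row_norm_ge0// lerDl.
by rewrite mulrC -ltr_pdivlMr// Hn0.
Qed.

(** Indexed by all of [nat] and zero from [n] on, so that as a sequence it equals its own
    truncation. *)
Definition unit_row (k : nat) : 'rV[K]_n := \row_j (j == k :> nat)%:R.

Lemma unit_row_ge k : (n <= k)%N -> unit_row k = 0.
Proof. by move=> nk; apply/rowP => j; rewrite !mxE ltn_eqF// (leq_trans (ltn_ord j)). Qed.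

Lemma row_norm_unit k : row_norm (unit_row k) <= 1.
Proof.
have [nk|kn] := leqP n k.
  by rewrite unit_row_ge// /row_norm big1// => j _; rewrite mxE normr0.
rewrite /row_norm (bigD1 (Ordinal kn))//= big1 ?addr0 ?mxE ?eqxx ?normr1// => j jk.
by rewrite mxE [_ == _ :> nat](negbTE jk) normr0.
Qed.

Definition lincomb (V : lmodType K) (v : nat -> V) (a : 'rV[K]_n) : V :=
  \sum_(j < n) a 0 j *: v j.

Lemma lincombL (V : lmodType K) (v : nat -> V) c x y :
  lincomb v (c *: x + y) = c *: lincomb v x + lincomb v y.
Proof.
rewrite /lincomb scaler_sumr -big_split; apply: eq_bigr => j _.
by rewrite !mxE scalerDl scalerA.
Qed.

Lemma lincomb_unit (V : lmodType K) (v : nat -> V) k : (k < n)%N -> lincomb v (unit_row k) = v k.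
Proof.
move=> kn; rewrite /lincomb (bigD1 (Ordinal kn))//= mxE eqxx scale1r big1 ?addr0// => j jk.
by rewrite mxE [_ == _ :> nat](negbTE jk) scale0r.
Qed.

Lemma lincomb_le (V : normedModType K) (v : nat -> V) (a : 'rV[K]_n) :
  `|lincomb v a| <= (\sum_(j < n) `|v j|) * row_norm a.
Proof.
apply: le_trans (ler_norm_sum _ _ _) _; rewrite mulr_suml; apply: ler_sum => j _.
by rewrite normrZ mulrC ler_wpM2l// row_norm_coord.
Qed.

Section Spaces.
Context {E2 : completeNormedModType K} (psi : nat -> E2) (ep : K).
Hypothesis ep0 : 0 < ep.

Definition perturbed_norm (a : 'rV[K]_n) : K := `|lincomb psi a| + ep * row_norm a.

Lemma perturbed_normD x y : perturbed_norm (x + y) <= perturbed_norm x + perturbed_norm y.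
Proof.
rewrite /perturbed_norm addrACA -mulrDr lerD//; last by rewrite ler_wpM2l ?row_normD// ltW.
by rewrite -[x]scale1r lincombL !scale1r ler_normD.
Qed.

Lemma perturbed_normZ c x : perturbed_norm (c *: x) = `|c| * perturbed_norm x.
Proof.
rewrite /perturbed_norm row_normZ mulrDr mulrCA; congr (_ + _).
rewrite -normrZ; congr normr; rewrite -[c *: x]addr0 lincombL.
by rewrite [X in _ + X]/lincomb big1 ?addr0// => j _; rewrite mxE scale0r.
Qed.

Lemma row_norm_le_perturbed a : ep * row_norm a <= perturbed_norm a.
Proof. by rewrite lerDr. Qed.

Lemma perturbed_norm_le a :
  perturbed_norm a <= (\sum_(j < n) `|psi j| + ep) * row_norm a.
Proof. by rewrite mulrDl lerD2r lincomb_le. Qed.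

Lemma perturbed_norm_eq0 x : perturbed_norm x = 0 -> x = 0.
Proof.
move=> x0; apply: row_norm_eq0; apply/eqP; rewrite eq_le row_norm_ge0 andbT.
by rewrite -(pmulr_rle0 _ ep0) -x0 row_norm_le_perturbed.
Qed.

Lemma perturbed_const_ge0 : 0 <= \sum_(j < n) `|psi j| + ep.
Proof. by rewrite addr_ge0 ?sumr_ge0// ltW. Qed.

(* [K ^ n] normed as the span of the vectors [(psi j, ep e_j)], which are
   linearly independent whether or not the [psi j] are. *)
Definition perturbed_span : completeNormedModType K :=
  banach_of perturbed_normD perturbed_normZ perturbed_norm_eq0
    (equivalent_norm_complete ep0 perturbed_const_ge0 row_norm_le_perturbed perturbed_norm_le).

(** The l_1-sum of [E2] and [K ^ n], chosen so that [a |-> (lincomb psi a, ep a)] is isometric for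
    [perturbed_norm]. *)
Definition sum_norm (g : E2 * 'rV[K]_n) : K := `|g.1| + row_norm g.2.

Lemma sum_normD x y : sum_norm (x + y) <= sum_norm x + sum_norm y.
Proof. by rewrite /sum_norm addrACA lerD ?ler_normD ?row_normD. Qed.

Lemma sum_normZ (c : K) x : sum_norm (c *: x) = `|c| * sum_norm x.
Proof. by rewrite /sum_norm mulrDr normrZ row_normZ. Qed.

Lemma sum_norm_eq0 x : sum_norm x = 0 -> x = 0.
Proof.
case: x => v a /eqP; rewrite /sum_norm paddr_eq0 ?row_norm_ge0//= normr_eq0.
by move=> /andP[/eqP -> /eqP /row_norm_eq0 ->].
Qed.

Lemma sum_norm_complete u : norm_cauchy sum_norm u -> exists l, norm_cvg sum_norm u l.
Proof.
move=> Hu.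
have [e e0|l1 Hl1] := @banach_seq_complete _ E2 (fun m => (u m).1).
  have [n0 Hn0] := Hu _ e0; exists n0 => p q n0p n0q.
  by apply: le_lt_trans (Hn0 _ _ n0p n0q); rewrite lerDl row_norm_ge0.
have [e e0|l2 Hl2] := @row_norm_complete (fun m => (u m).2).
  have [n0 Hn0] := Hu _ e0; exists n0 => p q n0p n0q.
  by apply: le_lt_trans (Hn0 _ _ n0p n0q); rewrite lerDr.
exists (l1, l2) => e e0; have e20 : 0 < e / 2 by rewrite divr_gt0.
have [n1 Hn1] := Hl1 _ e20; have [n2 Hn2] := Hl2 _ e20.
exists (maxn n1 n2) => m; rewrite geq_max => /andP[n1m n2m].
by rewrite [e]splitr ltrD//; [exact: Hn1|exact: Hn2].
Qed.

Definition sum_space : completeNormedModType K :=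
  banach_of sum_normD sum_normZ sum_norm_eq0 sum_norm_complete.

Lemma perturbed_embedding : exists i : {linear perturbed_span -> sum_space},
  (forall a, `|i a| = `|a|) /\
  forall a : 'rV[K]_n, i a = (lincomb psi a, ep *: a) :> E2 * 'rV[K]_n.
Proof.
have [|i Hi] := @linear_pack K perturbed_span sum_space
  (fun a : 'rV[K]_n => (lincomb psi a, ep *: a)).
  move=> c x y; congr pair; first exact: lincombL.
  have scaleL (x' y' : 'rV[K]_n) : ep *: (c *: x' + y') = c *: (ep *: x') + ep *: y'.
    by rewrite scalerDr !scalerA mulrC.
  exact: scaleL.
exists i; split => a; rewrite Hi//.
by congr (_ + _); rewrite row_normZ gtr0_norm.
Qed.

End Spaces.
End RowSpaces.

(** * Finite families in the bidual *)

Section LocalReflexivity.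
Context {R : realType} {b : bool}.
Local Notation K := (scalars R b).
Context (X : @seqclass K).
Hypothesis hX : is_seqclass X.
Hypothesis ls : linearly_stable X.
Hypothesis fi : finitely_injective X.

Lemma sc_norm_trunc_sum (E : completeNormedModType K) n (x : nat -> E) :
  sc_norm X E (trunc n x) <= \sum_(j < n) `|x j|.
Proof.
elim: n => [|n IH].
  by rewrite big_ord0 (_ : trunc 0 x = (fun _ => 0)) ?(sc_norm0 hX)//; exact/funext.
rewrite big_ord_recr truncS /=.
apply: le_trans (sc_normD hX (sc_mem_trunc hX _ _) (sc_mem_single hX _ _)) _.
by rewrite (sc_norm_single hX) lerD2r.
Qed.

(** The hypothesis says that [T : a |-> lincomb x a] has norm at most [B] on the perturbed span, so
    stability reduces [x] to the unit rows. Finite injectivity moves these into [sum_space], where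
    they split into [(psi k, 0)], controlled by stability of the inclusion of [E2], and
    [(0, ep e_k)], of total norm at most [ep n]. *)
Lemma sc_norm_dominated (E E2 : completeNormedModType K) n (x : nat -> E)
    (psi : nat -> E2) (ep B : K) : 0 < ep -> 0 <= B ->
  (forall a : 'rV[K]_n, `|lincomb x a| <= B * perturbed_norm psi ep a) ->
  sc_norm X E (trunc n x) <= B * (sc_norm X E2 (trunc n psi) + ep * n%:R).
Proof.
move=> ep0 B0 xB.
pose F := @perturbed_span R b n E2 psi ep ep0; pose G := @sum_space R b n E2.
have [T HT] := @linear_pack K F E (lincomb x) (lincombL x).
pose e : nat -> F := @unit_row R b n.
have eE : trunc n e = e.
  by apply/funext => k; rewrite /Defs.trunc; case: ltnP => // nk; rewrite /e unit_row_ge.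
have Se : sc_mem X F e by rewrite -eE; exact: sc_mem_trunc.
have -> : trunc n x = T \o e.
  apply/funext => k; rewrite /Defs.trunc /=; case: ltnP => kn.
    by rewrite HT lincomb_unit.
  have e0 : e k = 0 by exact: unit_row_ge.
  by rewrite e0 linear0.
have [|_] := sc_norm_linear hX ls B0 _ Se (T := T); first by move=> v; rewrite HT; exact: xB.
move=> /le_trans; apply; apply: ler_wpM2l => //.
have [i [ii Hi]] := @perturbed_embedding R b n E2 psi ep ep0.
rewrite -eE; apply: le_trans (fi ii n e) _.
have [|inl Hinl] := @linear_pack K E2 G (fun v => (v, 0)).
  move=> c v w; congr pair.
  have L0 : (0 : 'rV[K]_n) = c *: (0 : 'rV[K]_n) + 0 by rewrite scaler0 addr0.
  exact: L0.
have inl1 v : `|inl v| <= 1 * `|v|.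
  rewrite Hinl mul1r.
  have L1 : `|v| + row_norm (0 : 'rV[K]_n) <= `|v|.
    by rewrite /row_norm big1 ?addr0// => j _; rewrite mxE normr0.
  exact: L1.
pose w : nat -> G := fun k => (0, ep *: unit_row n k).
have -> : trunc n (i \o e) = (fun k => (inl \o trunc n psi) k + trunc n w k).
  apply/funext => k; rewrite /Defs.trunc /=; case: ltnP => kn; last by rewrite linear0 addr0.
  rewrite Hinl; have := Hi (unit_row n k); rewrite /e => ->; rewrite lincomb_unit//.
  have L2 : (psi k, ep *: unit_row n k) = (psi k + 0, 0 + ep *: unit_row n k).
    by rewrite addr0 add0r.
  exact: L2.
have [S1 N1] := sc_norm_linear hX ls ler01 inl1 (sc_mem_trunc hX n psi).
apply: le_trans (sc_normD hX S1 (sc_mem_trunc hX n w)) _.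
rewrite mul1r in N1; apply: lerD => //; apply: le_trans (sc_norm_trunc_sum _ _) _.
apply: (@le_trans _ _ (\sum_(j < n) ep)); last by rewrite sumr_const card_ord mulr_natr.
apply: ler_sum => j _.
have L3 : `|(0 : E2)| + row_norm (ep *: unit_row n j) <= ep.
  rewrite normr0 add0r row_normZ gtr0_norm// -[leRHS]mulr1 ler_wpM2l ?row_norm_unit//.
  exact: ltW.
exact: L3.
Qed.

Lemma finite_net n (dl : K) : 0 < dl -> exists (I : finType) (a : I -> 'rV[K]_n),
  forall x : 'rV[K]_n, row_norm x <= 1 -> exists i, row_norm (x - a i) <= dl * n%:R.
Proof.
move=> dl0; have [s Hs] := scal_net dl0.
exists {ffun 'I_n -> seq_sub s}, (fun f : {ffun 'I_n -> seq_sub s} => \row_j (ssval (f j))) => x x1.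
have /choice[g Hg] : forall j : 'I_n, exists w : seq_sub s, `|x 0 j - ssval w| <= dl.
  move=> j; have [|w ws Hw] := Hs (x 0 j); first exact: le_trans (row_norm_coord _ _) x1.
  by exists (SeqSub ws).
exists [ffun j => g j]; apply: (@le_trans _ _ (\sum_(j < n) dl)).
  by apply: ler_sum => j _; rewrite !mxE ffunE.
by rewrite sumr_const card_ord mulr_natr.
Qed.

Context {E E1 E2 : completeNormedModType K} (ev1 : E1 -> E -> K) (ev2 : E2 -> E1 -> K).
Hypothesis dp1 : dual_pairing ev1.
Hypothesis dp2 : dual_pairing ev2.

(* Plays the role of the principle of local reflexivity. *)
Lemma bidual_pairing_le n (phi : nat -> E1) (psi : nat -> E2) (c : K) : 0 <= c ->
  (forall x : nat -> E, `|\sum_(j < n) ev1 (phi j) (x j)| <= c * sc_norm X E (trunc n x)) ->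
  `|\sum_(j < n) ev2 (psi j) (phi j)| <= c * sc_norm X E2 (trunc n psi).
Proof.
move=> c0 Hc; set Np := sc_norm X E2 _.
have Np0 : 0 <= Np by apply/(sc_norm_ge0 hX)/sc_mem_trunc.
(* The constant comes from expanding [(1 + ep) (Np + ep n)]: the term [ep ^ 2 n] is at most [ep n]
   because [ep <= 1]. *)
apply: (@le_affine_eps _ _ _ _ (c * (Np + n%:R + n%:R))).
- exact: normr_real.
- by apply: ger0_real; rewrite mulr_ge0.
- by rewrite mulr_ge0// !addr_ge0.
move=> ep ep0 ep1.
have -> : c * Np + ep * (c * (Np + n%:R + n%:R)) = c * (Np + ep * (Np + n%:R + n%:R)).
  by ring.
apply: (@le_trans _ _ (c * ((1 + ep) * (Np + ep * n%:R)))); last first.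
  apply: ler_wpM2l => //; rewrite mulrDl mul1r -addrA lerD2l !mulrDr addrA.
  rewrite [ep * n%:R + _]addrC lerD2l; apply: ler_wpM2l; first exact: ltW.
  by rewrite -[leRHS]mul1r ler_wpM2r.
pose q := @perturbed_norm R b n E2 psi ep.
pose D : K := \sum_(j < n) `|psi j| + ep.
have D0 : 0 <= D by rewrite addr_ge0 ?sumr_ge0// ltW.
(* For [row_norm y = 1] the net errors below add up to [s dl (W - 1)]. Since [dl W = ep ^ 2] and
   [ep <= q y], they are absorbed in [s ep q y]; the final 1 in [W] also ensures [dl <= 1]. *)
pose W : K := D * n%:R + 1 + n%:R * (n%:R * (D + 1)) + 1.
have V0 : 0 <= D * n%:R + 1 + n%:R * (n%:R * (D + 1)).
  apply: addr_ge0; first by apply: addr_ge0 => //; exact: mulr_ge0.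
  by apply: mulr_ge0 => //; apply: mulr_ge0 => //; exact: addr_ge0.
have W0 : 0 < W by exact: ltr_wpDl.
pose dl := ep * ep / W.
have dl0 : 0 < dl by rewrite divr_gt0// mulr_gt0.
have dl1 : dl <= 1.
  rewrite ler_pdivrMr// mul1r; apply: (@le_trans _ _ 1).
    by rewrite -[leRHS]mulr1 ler_pM// ltW.
  by rewrite lerDr.
have [I [a Ha]] := finite_net n dl0.
(* The unit rows join the net so that the constraints bound each [x j] separately; without this the
   error of replacing [y] by a net point could not be estimated. *)
pose a' (i : I + 'I_n) : 'rV[K]_n := match i with inl i => a i | inr j => unit_row n j end.
(* A net point may be 0, where [q] vanishes; adding [dl] keeps the weights positive. *)
pose w i := q (a' i) + dl.
have q0 x : 0 <= q x by rewrite /q /perturbed_norm addr_ge0// mulr_ge0 ?row_norm_ge0// ltW.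
have w0 i : 0 < w i by rewrite ltr_wpDl.
pose a'' (i : I + 'I_n) (k : nat) : K := if insub k is Some j then a' i 0 j else 0.
have a''E i (V : lmodType K) (v : nat -> V) : \sum_(j < n) a'' i j *: v j = lincomb v (a' i).
  by apply: eq_bigr => j _; rewrite /a'' valK.
apply: (helly dp1 dp2 (a := a'') (w := w)) => //.
- by rewrite !mulr_ge0 ?addr_ge0// ?mulr_ge0// ltW.
- move=> i; rewrite a''E /w /q /perturbed_norm -addrA lerDl.
  apply: addr_ge0; last exact: ltW.
  by apply: mulr_ge0; [exact: ltW|exact: row_norm_ge0].
move=> x s s0 Hx; apply: le_trans (Hc x) _; rewrite -mulrA; apply: ler_wpM2l => //.
rewrite mulrC mulrA; apply: sc_norm_dominated => //.
  by rewrite mulr_ge0// addr_ge0// ltW.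
have xs (j : 'I_n) : `|x j| <= s * (D + 1).
  have := Hx (inr j); rewrite a''E /= lincomb_unit// => /le_trans; apply.
  apply: ler_wpM2l => //; rewrite /w /=; apply: lerD => //.
  apply: le_trans (perturbed_norm_le _ _ _) _.
  by rewrite -[leRHS]mulr1 ler_wpM2l// row_norm_unit.
(* The constraints on [x] at the net points and unit rows must yield a bound at every [y], to be fed
   to [sc_norm_dominated] with [B = s (1 + ep)]; homogeneity reduces it to the unit sphere. *)
have unit_case y : row_norm y = 1 -> `|lincomb x y| <= s * (1 + ep) * q y.
  move=> y1; have [|i Hi] := Ha y; first by rewrite y1.
  have -> : lincomb x y = lincomb x (y - a i) + lincomb x (a i).
    by have := lincombL x 1 (y - a i) (a i); rewrite !scale1r subrK.
  apply: le_trans (ler_normD _ _) _.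
  have h1 : `|lincomb x (y - a i)| <= s * (n%:R * (D + 1)) * (dl * n%:R).
    apply: le_trans (lincomb_le _ _) _; apply: ler_pM => //.
    - exact: sumr_ge0.
    - exact: row_norm_ge0.
    apply: (@le_trans _ _ (\sum_(j < n) s * (D + 1))); first by apply: ler_sum => j _.
    by rewrite sumr_const card_ord -[_ *+ _]mulr_natl mulrCA.
  have h2 : `|lincomb x (a i)| <= s * (q y + D * (dl * n%:R) + dl).
    have := Hx (inl i); rewrite a''E => /le_trans; apply; apply: ler_wpM2l => //.
    rewrite /w lerD2r /=.
    have -> : a i = y + (-1) *: (y - a i) by rewrite scaleN1r opprB addrC subrK.
    apply: le_trans (perturbed_normD psi ep0 _ _) _; rewrite lerD2l.
    rewrite perturbed_normZ normrN1 mul1r; apply: le_trans (perturbed_norm_le _ _ _) _.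
    exact: ler_wpM2l.
  apply: le_trans (lerD h1 h2) _; rewrite -mulrA -mulrDr -mulrA; apply: ler_wpM2l => //.
  have -> : n%:R * (D + 1) * (dl * n%:R) + (q y + D * (dl * n%:R) + dl) =
      q y + dl * (D * n%:R + 1 + n%:R * (n%:R * (D + 1))).
    by ring.
  have -> : (1 + ep) * q y = q y + ep * q y by ring.
  rewrite lerD2l; apply: (@le_trans _ _ (dl * W)).
    by apply: ler_wpM2l; [exact: ltW|rewrite /W lerDl].
  rewrite /dl mulfVK ?gt_eqF//; apply: ler_wpM2l; first exact: ltW.
  by rewrite -[leLHS]mulr1 -y1; exact: row_norm_le_perturbed.
move=> y; have [y0|y0] := eqVneq (row_norm y) 0.
  have -> : lincomb x y = 0.
    by rewrite (row_norm_eq0 y0) /lincomb big1// => j _; rewrite mxE scale0r.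
  by rewrite normr0 mulr_ge0// mulr_ge0// addr_ge0// ltW.
have yp : 0 < row_norm y by rewrite lt_neqAle eq_sym y0 row_norm_ge0.
have yi : 0 < (row_norm y)^-1 by rewrite invr_gt0.
have := unit_case ((row_norm y)^-1 *: y).
rewrite row_normZ (gtr0_norm yi) mulVf// => /(_ erefl).
have -> : lincomb x ((row_norm y)^-1 *: y) = (row_norm y)^-1 *: lincomb x y.
  by rewrite /lincomb scaler_sumr; apply: eq_bigr => j _; rewrite mxE scalerA.
by rewrite normrZ /q perturbed_normZ (gtr0_norm yi) mulrCA ler_pM2l.
Qed.

End LocalReflexivity.

(** * The duality map *)

Section Duality.
Context {R : realType} {b : bool}.
Local Notation K := (scalars R b).
Context (X : @seqclass K).
Hypothesis hX : is_seqclass X.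
Hypothesis ls : linearly_stable X.
Hypothesis fd : finitely_dominated X.
Hypothesis sph : spherically_complete X.
Context {E E1 E2 : completeNormedModType K} (ev1 : E1 -> E -> K) (ev2 : E2 -> E1 -> K).
Hypothesis dp1 : dual_pairing ev1.
Hypothesis dp2 : dual_pairing ev2.
Local Notation S := (sc_mem X E).
Local Notation N := (sc_norm X E).

(** The dual class of [E'] is tested on sequences in [E'']. The canonical embedding of [E] and
    linear stability turn each [x] in [X(E)] into such a test sequence, which is what drives (a). *)
Lemma pairing_via_bidual (x : nat -> E) : S x -> exists psi, [/\ sc_mem X E2 psi,
  sc_norm X E2 psi <= N x & forall j d, ev2 (psi j) d = ev1 d (x j)].
Proof.
move=> Sx; have [i [ii Hi]] := bidual_embedding dp1 dp2.
have [|Si Ni] := sc_norm_linear hX ls ler01 _ Sx (T := i).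
  by move=> v; rewrite ii mul1r.
by exists (i \o x); split => //=; rewrite mul1r in Ni.
Qed.

Lemma pairing_series_cvg (phi : nat -> E1) (x : nat -> E) :
  Xdual_mem X ev2 phi -> S x -> cvgn (series (fun j => ev1 (phi j) (x j))).
Proof.
move=> Hphi /pairing_via_bidual[psi [Spsi _ psiE]]; have := Hphi psi Spsi.
by rewrite (_ : (fun j => ev2 _ _) = (fun j => ev1 (phi j) (x j)))//; apply/funext => j.
Qed.

Lemma Jmap_cvg phi x : Xdual_mem X ev2 phi -> S x ->
  series (fun j => ev1 (phi j) (x j)) @ \oo --> Jmap ev1 phi x.
Proof. by move=> Hphi Sx; exact: pairing_series_cvg. Qed.

Lemma Jmap_eq (phi : nat -> E1) (x : nat -> E) (l : K) :
  series (fun j => ev1 (phi j) (x j)) @ \oo --> l -> Jmap ev1 phi x = l.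
Proof. exact: cvg_lim. Qed.

Lemma Jmap_linr phi a x y : Xdual_mem X ev2 phi -> S x -> S y ->
  Jmap ev1 phi (fun j => a *: x j + y j) = a * Jmap ev1 phi x + Jmap ev1 phi y.
Proof.
move=> Hphi Sx Sy; apply: Jmap_eq.
have -> : series (fun j => ev1 (phi j) (a *: x j + y j)) =
    (fun n => a * series (fun j => ev1 (phi j) (x j)) n + series (fun j => ev1 (phi j) (y j)) n).
  apply/funext => n; rewrite /series/= mulr_sumr -big_split; apply: eq_bigr => j _.
  exact: ev_linr.
by apply: cvgD; [apply: cvgMr|]; exact: Jmap_cvg.
Qed.

Lemma Jmap_linl a phi psi x : Xdual_mem X ev2 phi -> Xdual_mem X ev2 psi -> S x ->
  Jmap ev1 (fun j => a *: phi j + psi j) x = a * Jmap ev1 phi x + Jmap ev1 psi x.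
Proof.
move=> Hphi Hpsi Sx; apply: Jmap_eq.
have -> : series (fun j => ev1 (a *: phi j + psi j) (x j)) =
    (fun n => a * series (fun j => ev1 (phi j) (x j)) n + series (fun j => ev1 (psi j) (x j)) n).
  apply/funext => n; rewrite /series/= mulr_sumr -big_split; apply: eq_bigr => j _.
  exact: ev_linl.
by apply: cvgD; [apply: cvgMr|]; exact: Jmap_cvg.
Qed.

Lemma Jmap_bound phi c : Xdual_mem X ev2 phi -> Xdual_normis X ev2 phi c ->
  bounds_on X E (Jmap ev1 phi) c.
Proof.
move=> Hphi Hc x Sx; have c0 : 0 <= c by case: Hc.
have /norm_cvgP := Jmap_cvg Hphi Sx => /norm_cvg_norm_le; apply.
  by rewrite mulr_ge0// (sc_norm_ge0 hX).
have [psi [Spsi Npsi psiE]] := pairing_via_bidual Sx.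
move=> n; apply: le_trans (ler_norm_sum _ _ _) _.
apply: le_trans (ler_wpM2l c0 Npsi); have := Xdual_norm_le hX dp2 Hc Spsi n.
by congr (_ <= _); apply: eq_bigr => j _; rewrite psiE.
Qed.

Lemma Jmap_trunc (phi : nat -> E1) (x : nat -> E) n :
  Jmap ev1 phi (trunc n x) = \sum_(j < n) ev1 (phi j) (x j).
Proof.
apply: Jmap_eq; apply/norm_cvgP => e e0; exists n => m nm.
suff -> : series (fun j => ev1 (phi j) (trunc n x j)) m = \sum_(j < n) ev1 (phi j) (x j).
  by rewrite subrr normr0.
rewrite /series/= (big_cat_nat (n := n))//=.
rewrite [X in _ + X]big_nat_cond [X in _ + X]big1 ?addr0; last first.
  move=> j /andP[/andP[nj _] _]; rewrite /Defs.trunc ltnNge nj/=.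
  exact: (scalar_linear0 (fun a x y => ev_linr dp1 (phi j) a x y)).
by rewrite big_mkord; apply: eq_bigr => j _; rewrite /Defs.trunc ltn_ord.
Qed.

Lemma Jmap_inj (phi psi : nat -> E1) :
  (forall x, S x -> Jmap ev1 phi x = Jmap ev1 psi x) -> phi = psi.
Proof.
move=> HJ; apply/funext => k; apply: (ev_inj dp1) => v.
have := HJ _ (sc_mem_trunc hX k.+1 (single v k)).
have J f : Jmap ev1 f (trunc k.+1 (single v k)) = ev1 (f k) v.
  rewrite Jmap_trunc big_ord_recr/= /single eqxx big1 ?add0r// => j _.
  rewrite ltn_eqF//; exact: (scalar_linear0 (fun a x y => ev_linr dp1 (f j) a x y)).
by rewrite !J.
Qed.

Lemma Jmap_in_dual phi : Xdual_mem X ev2 phi -> in_XEdual X E (Jmap ev1 phi).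
Proof.
move=> Hphi; split=> [a x y Sx Sy|]; first exact: Jmap_linr.
by have [c Hc] := Xdual_norm_ex hX sph dp2 Hphi; exists c; exact: Jmap_bound.
Qed.

Section FinitelyInjective.
Hypothesis fi : finitely_injective X.

(** After rotation the sum of moduli is the pairing with [psi'], so the finite-family estimate
    applies. It serves both for the isometry and for showing that the coordinates of a functional
    lie in the dual class. *)
Lemma abs_bidual_pairing_le (phi : nat -> E1) (psi : nat -> E2) (c : K) : 0 <= c ->
  (forall n (x : nat -> E), `|\sum_(j < n) ev1 (phi j) (x j)| <= c * N (trunc n x)) ->
  sc_mem X E2 psi ->
  forall n, \sum_(0 <= j < n) `|ev2 (psi j) (phi j)| <= c * sc_norm X E2 psi.
Proof.
move=> c0 Hc Spsi n; have [psi' [S' N' E']] := rotate_pairing sph dp2 phi Spsi.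
under eq_bigr do rewrite -E'.
rewrite -N' big_mkord -[leLHS]ger0_norm; last by apply: sumr_ge0 => j _; rewrite E'.
apply: le_trans (bidual_pairing_le hX ls fi dp1 dp2 psi' c0 (Hc n)) _.
by apply: ler_wpM2l => //; exact: sc_norm_trunc_le.
Qed.

(** That [c] is a bound uses only test sequences coming from [E]. Minimality is the hard half: a
    bound known on [X(E)] has to control all test sequences in [X(E'')]. *)
Lemma Jmap_isometric phi c : Xdual_mem X ev2 phi -> Xdual_normis X ev2 phi c ->
  is_opnorm S N (Jmap ev1 phi) normr c.
Proof.
move=> Hphi Hc; split; [by case: Hc|exact: Jmap_bound|move=> c' c'0 Hc'].
case: Hc => _ _; apply => // psi Spsi N1 n.
apply: (@le_trans _ _ (c' * sc_norm X E2 psi)); last by rewrite -[leRHS]mulr1 ler_wpM2l.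
apply: abs_bidual_pairing_le => // m x; rewrite -Jmap_trunc; apply: Hc'.
exact: sc_mem_trunc.
Qed.

Lemma Jmap_surjective Phi : in_XEdual X E Phi ->
  exists2 phi, Xdual_mem X ev2 phi & forall x, S x -> Jmap ev1 phi x = Phi x.
Proof.
(* A constant in [bounds_on] need not be nonnegative, for instance when [X(E)] is trivial, hence the
   modulus. *)
move=> [PhiL [c0 Hc0]]; pose c := `|c0|.
have cge0 : 0 <= c by exact: normr_ge0.
have Hc x : S x -> `|Phi x| <= c * N x.
  move=> Sx; have N0 := sc_norm_ge0 hX Sx.
  have := le_trans (normr_ge0 _) (Hc0 x Sx) => h.
  apply: le_trans (Hc0 x Sx) _; rewrite -[leLHS]ger0_norm// normrM.
  by rewrite (ger0_norm N0).
have Phi0 : Phi (fun _ => 0) = 0.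
  by apply/eqP; rewrite -normr_le0; have := Hc _ (sc_mem0 hX E); rewrite (sc_norm0 hX) mulr0.
have PhiD x y : S x -> S y -> Phi (fun j => x j + y j) = Phi x + Phi y.
  move=> Sx Sy; have := PhiL 1 x y Sx Sy; rewrite mul1r => <-.
  by congr Phi; apply/funext => j; rewrite scale1r.
have /choice[phi Hphi] : forall j, exists d, forall v, ev1 d v = Phi (single v j).
  move=> j; have [a v w|v|d _ Hd] := @dual_rep R b _ _ _ dp1 (fun v => Phi (single v j)) c cge0.
  - rewrite -PhiL; [|exact: sc_mem_single|exact: sc_mem_single].
    by congr Phi; apply/funext => k; rewrite /single; case: ifP; rewrite ?scaler0 ?addr0.
  - by rewrite -(sc_norm_single hX v j); apply: Hc; exact: sc_mem_single.
  - by exists d.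
have PhiT n (x : nat -> E) : \sum_(j < n) ev1 (phi j) (x j) = Phi (trunc n x).
  elim: n => [|n IH].
    by rewrite big_ord0 -Phi0; congr Phi; exact/funext.
  rewrite big_ord_recr/= IH Hphi truncS PhiD//; [exact: sc_mem_trunc|exact: sc_mem_single].
exists phi.
  move=> psi Spsi; apply: (@abs_bounded_series_cvg _ _ _ (c * sc_norm X E2 psi)).
  apply: abs_bidual_pairing_le => // n x; rewrite PhiT; apply: Hc; exact: sc_mem_trunc.
move=> x Sx; apply: Jmap_eq; apply/norm_cvgP => e e0.
have c1 : 0 < c + 1 by rewrite ltr_wpDl.
(* Partial sums of the series are [Phi (trunc n x)], so vanishing tails and boundedness of [Phi]
   identify the limit; [c + 1] replaces [c] to allow the division. *)
have [|n0 Hn0] := sc_tail_lim0 hX fd Sx (e := e / (c + 1)); first by rewrite divr_gt0.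
exists n0 => n n0n; rewrite /series/= big_mkord PhiT distrC.
have St := sc_mem_trunc hX n x.
have -> : Phi x - Phi (trunc n x) = Phi (fun j => x j - trunc n x j).
  have := PhiL (-1) _ _ St Sx; rewrite mulN1r addrC => <-.
  by congr Phi; apply/funext => j; rewrite scaleN1r addrC.
have SB := sc_memB hX Sx St.
apply: le_lt_trans (Hc _ SB) _.
apply: (@le_lt_trans _ _ ((c + 1) * N (fun j => x j - trunc n x j))).
  by rewrite ler_wpM2r ?(sc_norm_ge0 hX)// lerDl.
by rewrite mulrC -ltr_pdivlMr// Hn0.
Qed.

End FinitelyInjective.
End Duality.

Theorem theorem2p10 (R : realType) (b : bool)
    (X : @seqclass (scalars R b))
    (E E1 E2 : completeNormedModType (scalars R b))
    (ev1 : E1 -> E -> scalars R b) (ev2 : E2 -> E1 -> scalars R b) :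
  is_seqclass X -> linearly_stable X -> finitely_dominated X ->
  spherically_complete X ->
  dual_pairing ev1 -> (* E1 = E' *)
  dual_pairing ev2 -> (* E2 = E1' = E'' *)
  (* (a) *)
  [/\ (forall phi x, Xdual_mem X ev2 phi -> sc_mem X E x ->
         cvgn (series (fun j => ev1 (phi j) (x j)))),
      (forall phi, Xdual_mem X ev2 phi -> in_XEdual X E (Jmap ev1 phi)),
      (forall (a : scalars R b) phi psi, Xdual_mem X ev2 phi -> Xdual_mem X ev2 psi ->
         forall x, sc_mem X E x ->
           Jmap ev1 (fun j => a *: phi j + psi j) x
             = a * Jmap ev1 phi x + Jmap ev1 psi x),
      ((forall phi, Xdual_mem X ev2 phi -> exists c, Xdual_normis X ev2 phi c) /\
       forall phi c, Xdual_mem X ev2 phi -> Xdual_normis X ev2 phi c ->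
         bounds_on X E (Jmap ev1 phi) c)
    & (forall phi psi, Xdual_mem X ev2 phi -> Xdual_mem X ev2 psi ->
         (forall x, sc_mem X E x -> Jmap ev1 phi x = Jmap ev1 psi x) ->
         phi = psi)]
  /\
  (finitely_injective X ->
   (* (b) J is isometric ... *)
   [/\ (forall phi c, Xdual_mem X ev2 phi -> Xdual_normis X ev2 phi c ->
          is_opnorm (sc_mem X E) (sc_norm X E) (Jmap ev1 phi) normr c),
       (* ... onto a complemented subspace of X(E)' *)
       (exists P : ((nat -> E) -> scalars R b) -> ((nat -> E) -> scalars R b),
          [/\ (forall Phi, in_XEdual X E Phi -> in_XEdual X E (P Phi)),
              (forall (a : scalars R b) Phi Psi, in_XEdual X E Phi -> in_XEdual X E Psi ->
                 forall x, sc_mem X E x ->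
                   P (fun y => a * Phi y + Psi y) x = a * P Phi x + P Psi x),
              (exists C : scalars R b, forall Phi c, in_XEdual X E Phi -> 0 <= c ->
                 bounds_on X E Phi c -> bounds_on X E (P Phi) (C * c)),
              (forall Phi, in_XEdual X E Phi -> exists2 phi, Xdual_mem X ev2 phi &
                 forall x, sc_mem X E x -> P Phi x = Jmap ev1 phi x)
            & (forall phi, Xdual_mem X ev2 phi ->
                 forall x, sc_mem X E x -> P (Jmap ev1 phi) x = Jmap ev1 phi x)])
     & (* (c) J is an isometric isomorphism onto X(E)' iff c00(E) is dense *)
       ((forall phi c, Xdual_mem X ev2 phi -> Xdual_normis X ev2 phi c ->
           is_opnorm (sc_mem X E) (sc_norm X E) (Jmap ev1 phi) normr c) /\
        (forall Phi, in_XEdual X E Phi -> exists2 phi, Xdual_mem X ev2 phi &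
           forall x, sc_mem X E x -> Jmap ev1 phi x = Phi x))
       <->
       (forall x, sc_mem X E x -> forall e : scalars R b, 0 < e ->
          exists2 y, finsupp y & sc_norm X E (fun j => x j - y j) < e)]).
Proof.
move=> hX ls fd sph dp1 dp2; split.
  split.
  - by move=> phi x; exact: pairing_series_cvg.
  - by move=> phi; exact: Jmap_in_dual.
  - by move=> a phi psi Hphi Hpsi x; exact: (Jmap_linl hX ls dp1 dp2).
  - by split=> [phi|phi c]; [exact: (Xdual_norm_ex hX sph dp2)|exact: (Jmap_bound hX ls dp1 dp2)].
  - by move=> phi psi _ _; exact: (Jmap_inj hX dp1).
move=> fi.
have iso phi c := Jmap_isometric hX ls fd sph dp1 dp2 fi (phi := phi) (c := c).
have surj := Jmap_surjective hX ls fd sph dp1 dp2 fi.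
split; first exact: iso.
- exists id; split => //.
  + by exists 1 => Phi c _ _; rewrite mul1r.
  + move=> Phi /surj[phi Hphi HJ]; exists phi => // x Sx; exact/esym/HJ.
- split=> [_ x Sx e e0|_]; last by split.
  have [n Hn] := sc_tail_lim0 hX fd Sx e0.
  by exists (trunc n x); [exact: finsupp_trunc|exact: Hn].
Qed.
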